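(* Let $\Omega\subset\mathbb{R}^N$ ($N\ge1$) be a bounded Lipschitz domain, $\mu_1,\mu_2>0$, $\beta\in\mathbb{R}$, and $1+4/N<p\le 2^*-1$ (no upper bound if $N=1,2$; $2^*-1=(N+2)/(N-2)$ if $N\ge3$). Then the set $A$ is star-shaped with respect to $(0,0)$. Moreover, there exists a positive constant $R=R(\Omega,N,p)$ such that if $\rho_1,\rho_2\ge0$ satisfy $$\Big[\max\{\mu_1\rho_1^{2r},\mu_2\rho_2^{2r}\}+\beta^+\rho_1^r\rho_2^r\Big](\rho_1+\rho_2)^{a-1}\le R(\Omega,N,p),$$ then $(\rho_1,\rho_2)\in A$.
   Context: $\beta^+=\max\{\beta,0\}$; $a=N(p-1)/4$, $r=\frac{p+1}{4}-\frac{N(p-1)}{8}$. $\lambda_1(\Omega)$ is the first Dirichlet eigenvalue of $-\Delta$ in $\Omega$. For $(u_1,u_2)\in H^1_0(\Omega;\mathbb{R}^2)$, $\mathcal{E}(u_1,u_2)=\frac12\int_\Omega(|\nabla u_1|^2+|\nabla u_2|^2)-\frac{1}{p+1}\int_\Omega(\mu_1|u_1|^{p+1}+2\beta|u_1|^{(p+1)/2}|u_2|^{(p+1)/2}+\mu_2|u_2|^{p+1})$. For $\rho_1,\rho_2\ge0$ and $\alpha\ge\lambda_1(\Omega)$: $\mathcal{M}=\{(u_1,u_2)\in H^1_0(\Omega;\mathbb{R}^2):\int_\Omega u_i^2=\rho_i\}$, $\mathcal{B}_\alpha=\{(u_1,u_2)\in\mathcal{M}:\int_\Omega|\nabla u_1|^2+|\nabla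 u_2|^2\le(\rho_1+\rho_2)\alpha\}$, $\mathcal{U}_\alpha=\{(u_1,u_2)\in\mathcal{M}:\int_\Omega|\nabla u_1|^2+|\nabla u_2|^2=(\rho_1+\rho_2)\alpha\}$, $c_\alpha=\inf_{\mathcal{B}_\alpha}\mathcal{E}$, $\hat c_\alpha=\inf_{\mathcal{U}_\alpha}\mathcal{E}$ (all depending on $(\rho_1,\rho_2)$). For $N\ge3$, $2^*=2N/(N-2)$, $S_N$ is the smallest constant with $\|v\|_{L^{2^*}(\mathbb{R}^N)}^{2^*}\le S_N\|\nabla v\|_{L^2(\mathbb{R}^N)}^{2^*}$ on $\mathcal{D}^{1,2}(\mathbb{R}^N)$, and $\Lambda=\frac{2S_N}{2^*}\max_{x^2+y^2=1}(\mu_1|x|^{2^*}+\mu_2|y|^{2^*}+2\beta^+|xy|^{2^*/2})$. The set of admissible masses is $A=\{(\rho_1,\rho_2)\in[0,\infty)^2:\ c_\alpha<\hat c_\alpha$ for some $\alpha\ge\lambda_1(\Omega)$, where in case $N\ge3$, $p=2^*-1$ $\alpha$ must also satisfy $(\rho_1+\rho_2)(\alpha-\lambda_1(\Omega))\le\Lambda^{-(N-2)/2}\}\cup\{(0,0)\}$. *)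

(* Defs.v *)
From HB Require Import structures.
From mathcomp Require Import all_boot all_order all_algebra.
From mathcomp Require Import all_classical all_reals all_analysis.

Set Implicit Arguments.
Unset Strict Implicit.
Unset Printing Implicit Defensive.

Import Order.TTheory GRing.Theory Num.Theory.
Import numFieldNormedType.Exports.

Local Open Scope classical_set_scope.
Local Open Scope ring_scope.

Section Defs.
Variable R : realType.

(* R^k is modelled as row vectors 'rV[R]_k.  For nonnegative Borel functions,
   the Lebesgue integral on R^k is (by Tonelli) the iterated one-dimensional
   Lebesgue integral, which we use as the definition. *)
Fixpoint iint (k : nat) : ('rV[R]_k -> R) -> \bar R :=
  match k return ('rV[R]_k -> R) -> \bar R with
  | 0 => fun f => (f 0)%:E
  | k'.+1 => fun f =>
      (\int[@lebesgue_measure R]_t iint (fun y : 'rV[R]_k' => f (row_mx (t%:M : 'rV[R]_1) y)))%E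
  end.

Variable N : nat.
Notation V := 'rV[R]_N.

Definition intO (Om : set V) (f : V -> R) : \bar R :=
  iint (fun x => \1_Om x * f x).

Definition borel_set (A : set V) : Prop := <<s [set U : set V | open U] >> A.
Definition borel_fun (f : V -> R) : Prop :=
  forall B : set (measurableTypeR R), measurable B -> borel_set (f @^-1` B).

Definition evec (i : 'I_N) : V := delta_mx 0 i.
Definition partial (i : 'I_N) (f : V -> R) : V -> R := fun x => 'D_(evec i) f x.
Fixpoint Dl (l : seq 'I_N) (f : V -> R) : V -> R :=
  match l with
  | [::] => f
  | i :: l' => partial i (Dl l' f)
  end.
Definition smooth (f : V -> R) : Prop :=
  forall (l : seq 'I_N) (x : V), differentiable (Dl l f) x.

Definition testfun (Om : set V) (f : V -> R) : Prop :=
  smooth f /\ exists K : set V, [/\ compact K, K `<=` Om & forall x, ~ K x -> f x = 0].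

Definition gradsq (g : 'I_N -> V -> R) (x : V) : R := \sum_i (g i x) ^+ 2.

(* H^1_0(Om): (u, g) where g is the weak gradient of u, u being the limit in
   the H^1 norm of test functions in C_c^infty(Om) (completion definition). *)
Definition H10 (Om : set V) (u : V -> R) (g : 'I_N -> V -> R) : Prop :=
  borel_fun u /\ (forall i, borel_fun (g i)) /\
  exists phi : nat -> V -> R,
    [/\ forall k, testfun Om (phi k),
        (fun k => iint (fun x => (phi k x - u x) ^+ 2)) @ \oo --> 0%E
      & (fun k => iint (gradsq (fun i x => partial i (phi k) x - g i x))) @ \oo --> 0%E].

Definition D12 (q : R) (v : V -> R) (g : 'I_N -> V -> R) : Prop :=
  borel_fun v /\ (forall i, borel_fun (g i)) /\
  exists phi : nat -> V -> R,
    [/\ forall k, testfun setT (phi k),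
        (fun k => iint (fun x => `|phi k x - v x| `^ q)) @ \oo --> 0%E
      & (fun k => iint (gradsq (fun i x => partial i (phi k) x - g i x))) @ \oo --> 0%E].

Definition L2sq (Om : set V) (u : V -> R) : \bar R := intO Om (fun x => u x ^+ 2).
Definition Dsq (Om : set V) (g : 'I_N -> V -> R) : \bar R := intO Om (gradsq g).

Definition lambda1 (Om : set V) : R :=
  inf [set r : R | exists (u : V -> R) (g : 'I_N -> V -> R),
        [/\ H10 Om u g, (0 < L2sq Om u < +oo)%E & r = fine (Dsq Om g) / fine (L2sq Om u)] ].

End Defs.

Section Domain.
Variables (R : realType) (n : nat).
Notation V := 'rV[R]_n.+1.

Definition firstn_coords (y : V) : 'rV[R]_n :=
  \row_(i < n) y 0 (widen_ord (leqnSn n) i).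

(* Omega is open, nonempty, connected, bounded, and near each boundary point
   it is (after a rigid change of coordinates) the strict epigraph of a
   Lipschitz function of n = N-1 variables. *)
Definition lipschitz_domain (Om : set V) : Prop :=
  [/\ open Om, Om !=set0, connected Om,
      (exists M : R, forall x, Om x -> `|x| <= M) &
      forall x0 : V, closure Om x0 -> ~ Om x0 ->
        exists (r : R) (Q : 'M[R]_n.+1) (gam : 'rV[R]_n -> R) (L : R),
          [/\ 0 < r, Q *m Q^T = 1%:M,
              (forall a b, `|gam a - gam b| <= L * `|a - b|) &
              forall x, ball x0 r x ->
                (Om x <-> gam (firstn_coords ((x - x0) *m Q)) < ((x - x0) *m Q) 0 ord_max)]].
End Domain.

Section Problem.
Variables (R : realType) (N : nat).
Notation V := 'rV[R]_N.
Local Open Scope ereal_scope.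

(* An element of H^1_0(Om;R^2) together with chosen weak gradients *)
Definition pairH := ((V -> R) * ('I_N -> V -> R) * (V -> R) * ('I_N -> V -> R))%type.

Definition energy (Om : set V) (p mu1 mu2 beta : R) (w : pairH) : \bar R :=
  let: (u1, g1, u2, g2) := w in
  (2^-1)%R%:E * (Dsq Om g1 + Dsq Om g2)
  - ((p + 1)^-1)%R%:E *
    ( mu1%:E * intO Om (fun x => `|u1 x| `^ (p + 1))%R
    + (2 * beta)%R%:E * intO Om (fun x => `|u1 x| `^ ((p + 1) / 2) * `|u2 x| `^ ((p + 1) / 2))%R
    + mu2%:E * intO Om (fun x => `|u2 x| `^ (p + 1))%R).

Definition Mset (Om : set V) (rho1 rho2 : R) : set pairH :=
  [set w | let: (u1, g1, u2, g2) := w in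
     [/\ H10 Om u1 g1, H10 Om u2 g2, L2sq Om u1 = rho1%:E & L2sq Om u2 = rho2%:E]].

Definition gradsum (Om : set V) (w : pairH) : \bar R :=
  let: (u1, g1, u2, g2) := w in Dsq Om g1 + Dsq Om g2.

Definition Bset (Om : set V) (rho1 rho2 alpha : R) : set pairH :=
  [set w | Mset Om rho1 rho2 w /\ gradsum Om w <= ((rho1 + rho2) * alpha)%R%:E].
Definition Uset (Om : set V) (rho1 rho2 alpha : R) : set pairH :=
  [set w | Mset Om rho1 rho2 w /\ gradsum Om w = ((rho1 + rho2) * alpha)%R%:E].

Definition c_alpha (Om : set V) (p mu1 mu2 beta rho1 rho2 alpha : R) : \bar R :=
  ereal_inf (energy Om p mu1 mu2 beta @` Bset Om rho1 rho2 alpha).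
Definition chat_alpha (Om : set V) (p mu1 mu2 beta rho1 rho2 alpha : R) : \bar R :=
  ereal_inf (energy Om p mu1 mu2 beta @` Uset Om rho1 rho2 alpha).

Local Close Scope ereal_scope.

Definition crit_exp : R := 2 * N%:R / (N%:R - 2).

Definition sobolev_const : R :=
  inf [set S : R | forall (v : V -> R) (g : 'I_N -> V -> R), D12 crit_exp v g ->
        (iint (fun x => `|v x| `^ crit_exp)%R
           <= (S * (fine (iint (gradsq g))) `^ (crit_exp / 2))%:E)%E].

Definition Lambda (mu1 mu2 beta : R) : R :=
  (2 * sobolev_const / crit_exp) *
  sup [set m : R | exists x y : R, x ^+ 2 + y ^+ 2 = 1 /\
        m = mu1 * `|x| `^ crit_exp + mu2 * `|y| `^ crit_exp
            + 2 * Num.max beta 0 * `|x * y| `^ (crit_exp / 2)].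

Definition critical (p : R) : Prop := (2 < N)%N /\ p = crit_exp - 1.

Definition admissible (Om : set V) (p mu1 mu2 beta : R) : set (R * R) :=
  [set rho | (0 <= rho.1 /\ 0 <= rho.2 /\
     exists alpha : R, [/\ lambda1 Om <= alpha,
        (c_alpha Om p mu1 mu2 beta rho.1 rho.2 alpha
           < chat_alpha Om p mu1 mu2 beta rho.1 rho.2 alpha)%E &
        (critical p -> (rho.1 + rho.2) * (alpha - lambda1 Om)
                         <= Lambda mu1 mu2 beta `^ (- ((N%:R - 2) / 2)))])
     \/ rho = (0, 0)].

Definition star_shaped0 (A : set (R * R)) : Prop :=
  forall rho t, A rho -> 0 <= t <= 1 -> A (t * rho.1, t * rho.2).
End Problem.

(* Main.v *)
Require Import Defs.
From HB Require Import structures.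
From mathcomp Require Import all_boot all_order all_algebra.
From mathcomp Require Import all_classical all_reals all_analysis.
From mathcomp Require Import measurable_realfun ring lra.
Import Order.TTheory GRing.Theory Num.Theory.
Import numFieldNormedType.Exports.
Local Open Scope classical_set_scope.
Local Open Scope ring_scope.
Set Implicit Arguments.
Unset Strict Implicit.
Unset Printing Implicit Defensive.

(* Star-shapedness: with alpha fixed, u |-> sqrt t u maps B_alpha, U_alpha for
   rho onto those for t rho, and E(sqrt t u) = t (s E(u) + (1 - s) G(u) / 2) with
   G the Dirichlet energy and s = t^((p-1)/2) <= 1. As G <= (rho1 + rho2) alpha
   on B_alpha, with equality on U_alpha, the gap c_alpha < chat_alpha survives.

   Small masses: take two normalized bumps phi1, phi2 in Om with disjoint supports
   (so that the coupling term vanishes whatever the sign of beta), K a bound for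
   their Dirichlet energies and alpha = K + 1. The competitor
   (sqrt rho1 phi1, sqrt rho2 phi2) gives c_alpha <= (rho1 + rho2) K / 2, while the
   Gagliardo-Nirenberg inequality
     int |u|^(p+1) <= C (int |grad u|^2)^a (int u^2)^(2 r)
   bounds the interaction terms on U_alpha by (rho1 + rho2) / 4 when R is small, so
   chat_alpha >= (rho1 + rho2) (K / 2 + 1 / 4). In the critical case the extra
   constraint on alpha follows from the same smallness because r = 0, once the
   Sobolev constant is known to be finite and positive.

   The Gagliardo-Nirenberg inequality is proved for test functions from the L^1
   inequality of Gagliardo, Nirenberg and Sobolev applied to |phi|^c with
   c = (p + 1) (N - 1) / N, interpolation and absorption, and passes to H^1_0 by
   truncation and monotone convergence. *)

(** The exponent [c] is forced by [c * N / (N - 1) = p + 1]. Cauchy-Schwarz bounds the integral of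
    the gradient of |phi|^c through that of |phi|^(2c-2), and 2c - 2 lies between 2 and p + 1: the
    upper end is exactly the Sobolev restriction on p, while p > 1 + 4/N gives c > 2, so that
    |phi|^c is differentiable also where phi vanishes. The integral of |phi|^(p+1) then reappears on
    the right with a power below 1. Absorbing it requires that it be finite, which is why test
    functions come first. Approximation in H^1_0 controls only the L^2 norm, hence the truncation at
    a height M, with the approximating function chosen after M.

    Integrals are iterated ones, so linearity, Hölder and changes of order are obtained by
    representing them on a product measure. Real [inf] and [sup] are 0 on empty or unbounded sets;
    therefore lambda_1, the Sobolev constant and Lambda can be estimated only after their defining
    sets are shown to be nonempty and bounded. [K], alpha and all constants are fixed before mu1,
    mu2, beta and the masses, so that R depends on Om, N and p only. *)

(** * Borel functions on row vectors *)

Section Measurability.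
Variable R : realType.

(* Measurability of [f] tested against all maps with measurable coordinates:
   row vectors carry no canonical sigma-algebra. *)
Definition bmeas (k : nat) (f : 'rV[R]_k -> R) : Prop :=
  forall d (T : measurableType d) (h : T -> 'rV[R]_k),
    (forall i, measurable_fun setT (fun t => h t 0 i)) ->
    measurable_fun setT (fun t => f (h t)).

(** An open set is a countable union of sup-norm balls with rational centres and radii, and
    membership in such a ball is a finite conjunction of conditions on single coordinates. *)
Lemma open_preimage_measurable k (U : set 'rV[R]_k) d (T : measurableType d)
    (h : T -> 'rV[R]_k) :
  open U -> (forall i, measurable_fun setT (fun t => h t 0 i)) ->
  measurable (h @^-1` U).
Proof.
move=> oU mh.
pose box (q : 'rV[rat]_k * rat) : set 'rV[R]_k :=
  [set x | forall i, `|ratr (q.1 0 i) - x 0 i| < ratr q.2].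
have -> : h @^-1` U = \bigcup_(q in [set q | box q `<=` U]) (h @^-1` (box q)).
  apply/seteqP; split=> t /=; last by move=> [q qU hq]; exact: qU.
  move=> Ut; have /nbhs_ballP[e /= e0 eU] := open_nbhs_nbhs (conj oU Ut).
  (* Half of [e], because [h t] and [x] are both within [ratr e'] of the rational centre. *)
  have [e' e'0 e'e] : exists2 e' : rat, 0 < ratr e' :> R & ratr e' < e / 2.
    have [q] := @rat_in_itvoo R 0 (e / 2) ltac:(by rewrite divr_gt0).
    by rewrite in_itv/= => /andP[q0 qe]; exists q.
  have H i : exists q : rat, `|ratr q - h t 0 i| < ratr e'.
    have [q] := @rat_in_itvoo R (h t 0 i - ratr e') (h t 0 i + ratr e')
      ltac:(by rewrite ltrD2l gt0_cp).
    by rewrite in_itv/= => /andP[q0 qe]; exists q; rewrite ltr_distl q0.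
  have [q qP] := choice H.
  exists (\row_i q i, e') => /=; last by move=> i; rewrite mxE.
  move=> x /= xq; apply: eU; split=> // i j; rewrite !ord1 /ball/=.
  have := xq j; rewrite mxE => xj.
  rewrite -[X in X < _]/(`|h t 0 j - x 0 j|).
  rewrite (_ : _ - _ = (h t 0 j - ratr (q j)) + (ratr (q j) - x 0 j)); last by ring.
  rewrite (le_lt_trans (ler_normD _ _))// [e]splitr ltrD//.
    by rewrite distrC (lt_trans (qP j)).
  exact: lt_trans xj _.
rewrite bigcup_mkcond; apply: countable_bigcupT_measurable => // q.
case: ifPn => // _.
rewrite (_ : _ @^-1` _ = \bigcap_(i in [set: 'I_k])
   ((fun t => `|ratr (q.1 0 i) - h t 0 i|) @^-1` `]-oo, ratr q.2[)); last first.
  by apply/seteqP; split=> t /= H i; [move=> _|]; have := H i;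
    rewrite /= in_itv/= //; apply.
apply: fin_bigcap_measurable => // i _.
rewrite -[X in measurable X]setTI.
have : measurable_fun setT (fun t => `|ratr (q.1 0 i) - h t 0 i|).
  by apply: measurableT_comp => //; apply: measurable_funB.
by apply.
Qed.

Lemma borel_set_preimage k (A : set 'rV[R]_k) d (T : measurableType d)
    (h : T -> 'rV[R]_k) :
  borel_set A -> (forall i, measurable_fun setT (fun t => h t 0 i)) ->
  measurable (h @^-1` A).
Proof.
move=> bA mh; apply: (bA [set B | measurable (h @^-1` B)]); split; last first.
  by move=> U /= oU; exact: open_preimage_measurable.
split => /=.
- by rewrite preimage_set0.
- move=> B mB; rewrite setTD preimage_setC; exact: measurableC.
- by move=> F mF; rewrite preimage_bigcup; exact: bigcupT_measurable.
Qed.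

Lemma borel_fun_bmeas k (f : 'rV[R]_k -> R) : borel_fun f -> bmeas f.
Proof.
move=> bf d T h mh _ B mB; rewrite setTI.
by apply: (borel_set_preimage (bf B mB)).
Qed.

Lemma continuous_borel_fun k (f : 'rV[R]_k -> R) : continuous f -> borel_fun f.
Proof.
move=> /continuousP cf B.
rewrite RGenOpens.measurableE => mB.
apply: (mB [set B | borel_set (f @^-1` B)]); split; last first.
  move=> U [x [y ->]] /=; apply: sub_gen_smallest => /=; apply: cf; exact: interval_open.
have [h0 hC hU] := @smallest_sigma_algebra _ setT [set U : set 'rV[R]_k | open U].
split => /=.
- by rewrite preimage_set0.
- by move=> A mA; rewrite setTD preimage_setC -setTD; exact: hC.
- by move=> F mF; rewrite preimage_bigcup; exact: hU.
Qed.

Lemma bmeas_comp k (F : R -> R) (f : 'rV[R]_k -> R) :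
  measurable_fun setT F -> bmeas f -> bmeas (fun x => F (f x)).
Proof. by move=> mF mf d T h mh; apply: measurableT_comp => //; exact: mf. Qed.

Lemma bmeas_cst k (c : R) : bmeas (fun _ : 'rV[R]_k => c).
Proof. by move=> d T h mh; exact: measurable_cst. Qed.

Lemma bmeasD k (f g : 'rV[R]_k -> R) :
  bmeas f -> bmeas g -> bmeas (fun x => f x + g x).
Proof. by move=> mf mg d T h mh; apply: measurable_funD; [exact: mf|exact: mg]. Qed.

Lemma bmeasB k (f g : 'rV[R]_k -> R) :
  bmeas f -> bmeas g -> bmeas (fun x => f x - g x).
Proof. by move=> mf mg d T h mh; apply: measurable_funB; [exact: mf|exact: mg]. Qed.

Lemma bmeasM k (f g : 'rV[R]_k -> R) :
  bmeas f -> bmeas g -> bmeas (fun x => f x * g x).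
Proof. by move=> mf mg d T h mh; apply: measurable_funM; [exact: mf|exact: mg]. Qed.

Lemma bmeasX k (f : 'rV[R]_k -> R) m :
  bmeas f -> bmeas (fun x => f x ^+ m).
Proof. by move=> mf d T h mh; apply: measurable_funX; exact: mf. Qed.

Lemma bmeas_norm k (f : 'rV[R]_k -> R) :
  bmeas f -> bmeas (fun x => `|f x|).
Proof. by move=> mf; apply: bmeas_comp mf; exact: normr_measurable. Qed.

Lemma bmeas_powR k (f : 'rV[R]_k -> R) (q : R) :
  bmeas f -> bmeas (fun x => f x `^ q).
Proof. by move=> mf; apply: (bmeas_comp (F := fun y => y `^ q)) => //; exact: measurable_powR. Qed.

Lemma bmeas_min k (f g : 'rV[R]_k -> R) :
  bmeas f -> bmeas g -> bmeas (fun x => Num.min (f x) (g x)).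
Proof.
move=> mf mg d T h mh.
by apply: (@measurable_minr _ _ _ _ (fun t => f (h t)) (fun t => g (h t))); [exact: mf|exact: mg].
Qed.

Lemma bmeas_sum k (I : Type) (r : seq I) (f : I -> 'rV[R]_k -> R) :
  (forall i, bmeas (f i)) -> bmeas (fun x => \sum_(i <- r) f i x).
Proof.
by move=> mf d T h mh; apply: measurable_sum => i; exact: mf.
Qed.

Lemma bmeas_gradsq k (g : 'I_k -> 'rV[R]_k -> R) :
  (forall i, bmeas (g i)) -> bmeas (gradsq g).
Proof. by move=> mg; apply: bmeas_sum => i; exact: bmeasX. Qed.

Lemma bmeas_indic k (A : set 'rV[R]_k) : open A -> bmeas (\1_A).
Proof.
move=> oA d T h mh; rewrite (_ : (fun t => _) = \1_(h @^-1` A)).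
  by apply: measurable_indic; exact: open_preimage_measurable.
by apply/funext => t; rewrite !indicE; congr (nat_of_bool _)%:R.
Qed.

Lemma continuous_bmeas k (f : 'rV[R]_k -> R) : continuous f -> bmeas f.
Proof. by move=> cf; apply: borel_fun_bmeas; exact: continuous_borel_fun. Qed.

Lemma row_mx_coord0 k (t : R) (y : 'rV[R]_k) :
  row_mx (t%:M : 'rV[R]_1) y 0 ord0 = t.
Proof.
rewrite (_ : ord0 = lshift k (ord0 : 'I_1)); last exact: val_inj.
by rewrite row_mxEl mxE eqxx.
Qed.

Lemma row_mx_coordS k (t : R) (y : 'rV[R]_k) (i : 'I_k) :
  row_mx (t%:M : 'rV[R]_1) y 0 (lift ord0 i) = y 0 i.
Proof.
rewrite (_ : lift ord0 i = rshift 1 i); last exact: val_inj.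
by rewrite row_mxEr.
Qed.

Lemma row_mx_measurable k d (T : measurableType d) (s : T -> R) (h : T -> 'rV[R]_k) :
  measurable_fun setT s -> (forall i, measurable_fun setT (fun t => h t 0 i)) ->
  forall i, measurable_fun setT (fun t => row_mx ((s t)%:M : 'rV[R]_1) (h t) 0 i).
Proof.
move=> ms mh i; have [->|[j ->]] : i = ord0 \/ exists j, i = lift ord0 j.
  by case: (unliftP ord0 i) => [j ->|->]; [right; exists j|left].
- rewrite (_ : (fun t => _) = s); first exact: ms.
  by apply/funext => t; exact: row_mx_coord0.
- rewrite (_ : (fun t => _) = (fun t => h t 0 j)); first exact: mh.
  by apply/funext => t; exact: row_mx_coordS.
Qed.

Lemma bmeas_slice k (f : 'rV[R]_k.+1 -> R) (t : R) :
  bmeas f -> bmeas (fun y : 'rV[R]_k => f (row_mx (t%:M : 'rV[R]_1) y)).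
Proof.
by move=> mf d T h mh; apply: mf => i; exact: (row_mx_measurable (s := fun=> t)).
Qed.

End Measurability.

(** * Sigma-finiteness of product measures *)

Section ProductSigmaFinite.
Context d1 d2 (T1 : measurableType d1) (T2 : measurableType d2) (R : realType).
Variable m1 : {sigma_finite_measure set T1 -> \bar R}.
Variable m2 : {sigma_finite_measure set T2 -> \bar R}.

(** A named copy to which sigma-finiteness is attached, so that products can be iterated along the
    dimension. *)
Definition product_measure := (m1 \x m2)%E.
HB.instance Definition _ := Measure.on product_measure.

Lemma product_measure_sigma_finite : sigma_finite setT product_measure.
Proof.
have [F FT Ff] := sigma_finiteT m1.
have [G GT Gf] := sigma_finiteT m2.
(* Decoding pairs merges the two exhausting sequences into one; integers that code no pair
   contribute the empty set. *)
exists (fun n => if @unpickle (nat * nat)%type n is Some ij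
                 then F ij.1 `*` G ij.2 else set0).
  apply/seteqP; split=> // -[x y] _.
  have : setT x by []. rewrite FT => -[i _ Fi].
  have : setT y by []. rewrite GT => -[j _ Gj].
  by exists (pickle (i, j)) => //; rewrite pickleK.
move=> n; case: unpickle => [[i j]|]; last by rewrite measure0.
have [mF Fi] := Ff i; have [mG Gi] := Gf j.
split; first exact: measurableX.
by rewrite /product_measure product_measure1E//= lte_mul_pinfty// ge0_fin_numE.
Qed.

HB.instance Definition _ := Measure_isSigmaFinite.Build _ _ _ product_measure
  product_measure_sigma_finite.

Definition product_sfm : {sigma_finite_measure set (T1 * T2)%type -> \bar R} :=
  product_measure.
End ProductSigmaFinite.

(** * Iterated integrals as integrals against a measure *)

Section Representation.
Variable R : realType.

(* Tonelli's theorem: the iterated integral is an integral against a genuine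
   product measure. *)
Lemma iint_rep (k : nat) : exists d (T : measurableType d)
    (mu : {sigma_finite_measure set T -> \bar R}) (dec : T -> 'rV[R]_k),
  (forall i, measurable_fun setT (fun t => dec t 0 i)) /\
  forall f : 'rV[R]_k -> R, bmeas f -> (forall x, 0 <= f x) ->
    iint f = (\int[mu]_x (f (dec x))%:E)%E.
Proof.
elim: k => [|k [d [T [mu [dec [mdec IH]]]]]].
  (* In dimension 0 the iterated integral is evaluation at the only row vector, hence a Dirac
     mass. *)
  exists _, R, (@dirac _ R 0 R), (fun=> 0); split=> [i|f mf f0].
    exact: measurable_cst.
  by rewrite integral_dirac//= diracT mul1e.
exists _, _, (product_sfm (@lebesgue_measure R) mu),
  (fun z => row_mx (z.1%:M : 'rV[R]_1) (dec z.2)).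
have mrow : forall i, measurable_fun setT
    (fun z : measurableTypeR R * T => row_mx (z.1%:M : 'rV[R]_1) (dec z.2) 0 i).
  apply: row_mx_measurable; first exact: measurable_fst.
  by move=> i; apply: (measurableT_comp (mdec i)); exact: measurable_snd.
split=> // f mf f0 /=.
rewrite fubini_tonelli1//; last 2 first.
- by apply/measurable_EFinP; exact: mf.
- by move=> z; rewrite lee_fin.
apply: eq_integral => t _; rewrite IH//.
exact: bmeas_slice.
Qed.

End Representation.

(** * Calculus of the iterated integral: monotone convergence, Hölder, Tonelli *)

Section IteratedIntegral.
Variable R : realType.
Local Notation mu := (@lebesgue_measure R).

Lemma iint_ge0 k (f : 'rV[R]_k -> R) : (forall x, 0 <= f x) -> (0 <= iint f)%E.
Proof.
elim: k f => [|k IH] f f0 /=; first by rewrite lee_fin.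
by apply: integral_ge0 => t _; apply: IH => y.
Qed.

Lemma iint0 k : iint (fun _ : 'rV[R]_k => 0) = 0%E.
Proof.
elim: k => [//|k IH] /=; under eq_integral do rewrite IH.
exact: integral0.
Qed.

Lemma le_iint k (f g : 'rV[R]_k -> R) : bmeas f -> bmeas g ->
  (forall x, 0 <= f x) -> (forall x, f x <= g x) -> (iint f <= iint g)%E.
Proof.
move=> mf mg f0 fg; have [d [T [nu [dec [mdec H]]]]] := @iint_rep R k.
have g0 x : 0 <= g x := le_trans (f0 x) (fg x).
rewrite !H//; apply: ge0_le_integral => //.
- by move=> x _; rewrite lee_fin.
- by apply/measurable_EFinP; exact: mf.
- by apply/measurable_EFinP; exact: mg.
- by move=> x _; rewrite lee_fin.
Qed.

Lemma iintD k (f g : 'rV[R]_k -> R) : bmeas f -> bmeas g ->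
  (forall x, 0 <= f x) -> (forall x, 0 <= g x) ->
  iint (fun x => f x + g x) = (iint f + iint g)%E.
Proof.
move=> mf mg f0 g0; have [d [T [nu [dec [mdec H]]]]] := @iint_rep R k.
rewrite !H//; [|exact: bmeasD|by move=> x; exact: addr_ge0].
under eq_integral do rewrite EFinD.
apply: ge0_integralD => //.
- by move=> x _; rewrite lee_fin.
- by apply/measurable_EFinP; exact: mf.
- by move=> x _; rewrite lee_fin.
- by apply/measurable_EFinP; exact: mg.
Qed.

Lemma iintZ k (c : R) (f : 'rV[R]_k -> R) : 0 <= c -> bmeas f ->
  (forall x, 0 <= f x) -> iint (fun x => c * f x) = (c%:E * iint f)%E.
Proof.
move=> c0 mf f0; have [d [T [nu [dec [mdec H]]]]] := @iint_rep R k.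
rewrite !H//; [|by apply: bmeasM => //; exact: bmeas_cst|by move=> x; exact: mulr_ge0].
under eq_integral do rewrite EFinM.
apply: ge0_integralZl => //.
- by apply/measurable_EFinP; exact: mf.
- by move=> x _; rewrite lee_fin.
Qed.

(** Monotone convergence for sequences that are eventually constant at each point, as truncations at
    growing heights are. *)
Lemma iint_le_of_nd_seq k (f : nat -> 'rV[R]_k -> R) (g : 'rV[R]_k -> R) (c : \bar R) :
  (forall n, bmeas (f n)) -> bmeas g -> (forall n x, 0 <= f n x) ->
  (forall x, nondecreasing_seq (f ^~ x)) ->
  (forall x, \forall n \near \oo, f n x = g x) ->
  (forall n, (iint (f n) <= c)%E) -> (iint g <= c)%E.
Proof.
move=> mf mg f0 nd fg fc; have [d [T [nu [dec [mdec H]]]]] := @iint_rep R k.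
have g0 x : 0 <= g x.
  by have [n _ /(_ n (leqnn n)) <-] := fg x.
rewrite H//.
have E x : (g (dec x))%:E = limn (fun n => (f n (dec x))%:E).
  apply/esym/cvg_lim => //; apply: cvg_near_cst.
  by apply: filterS (fg (dec x)) => n ->.
under eq_integral do rewrite E.
rewrite monotone_convergence//; first last.
- by move=> x _ m n mn; rewrite lee_fin; exact: nd.
- by move=> n x _; rewrite lee_fin.
- by move=> n; apply/measurable_EFinP; exact: mf.
apply: lime_le.
  apply: ereal_nondecreasing_is_cvgn => m n mn; apply: ge0_le_integral => //.
  + by move=> x _; rewrite lee_fin.
  + by apply/measurable_EFinP; exact: mf.
  + by apply/measurable_EFinP; exact: mf.
  + by move=> x _; rewrite lee_fin; exact: nd.
by apply: nearW => n; rewrite -H.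
Qed.

Lemma young_powR (a b th : R) : 0 <= a -> 0 <= b -> 0 < th < 1 ->
  a `^ th * b `^ (1 - th) <= th * a + (1 - th) * b.
Proof.
move=> a0 b0 /andP[t0 t1].
have t10 : 0 < 1 - th by rewrite subr_gt0.
have := @conjugate_powR R (a `^ th) (b `^ (1 - th)) th^-1 (1 - th)^-1
  (powR_ge0 _ _) (powR_ge0 _ _).
rewrite !invrK -!powRrM !mulfV ?gt_eqF// !powRr1// => H.
apply: le_trans (H _ _ _) _; rewrite ?invr_gt0//; first by lra.
by rewrite [a * _]mulrC [b * _]mulrC.
Qed.

(** Young's inequality is applied pointwise to [f x / A] and [g x / B] and then integrated. Since
    [A] and [B] are positive upper bounds rather than the integrals themselves, null and infinite
    integrals need no separate treatment here. *)
Lemma iint_hoelder k (f g : 'rV[R]_k -> R) (th A B : R) :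
  bmeas f -> bmeas g -> (forall x, 0 <= f x) -> (forall x, 0 <= g x) ->
  0 < th < 1 -> 0 < A -> 0 < B -> (iint f <= A%:E)%E -> (iint g <= B%:E)%E ->
  (iint (fun x => f x `^ th * g x `^ (1 - th))%R <= (A `^ th * B `^ (1 - th))%:E)%E.
Proof.
move=> mf mg f0 g0 th01 A0 B0 fA gB; have /andP[t0 t1] := th01.
have t10 : 0 < 1 - th by rewrite subr_gt0.
set C := A `^ th * B `^ (1 - th).
have C0 : 0 < C by rewrite mulr_gt0 ?powR_gt0.
have cf0 : 0 <= C * th / A by apply: divr_ge0; [apply: mulr_ge0|]; exact: ltW.
have cg0 : 0 <= C * (1 - th) / B by apply: divr_ge0; [apply: mulr_ge0|]; exact: ltW.
have iA : 0 <= A^-1 by rewrite invr_ge0 ltW.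
have iB : 0 <= B^-1 by rewrite invr_ge0 ltW.
have mZ (c : R) h : bmeas h -> bmeas (fun x : 'rV[R]_k => c * h x).
  by move=> mh; apply: bmeasM => //; exact: bmeas_cst.
apply: (@le_trans _ _ (iint (fun x => C * th / A * f x + C * (1 - th) / B * g x))).
  apply: le_iint.
  - by apply: bmeasM; exact: bmeas_powR.
  - by apply: bmeasD; exact: mZ.
  - by move=> x; rewrite mulr_ge0 ?powR_ge0.
  move=> x; have := @young_powR (f x / A) (g x / B) th
    (divr_ge0 (f0 x) (ltW A0)) (divr_ge0 (g0 x) (ltW B0)) th01.
  rewrite !powRM// => H.
  have -> : f x `^ th * g x `^ (1 - th) =
    C * (f x `^ th * A^-1 `^ th * (g x `^ (1 - th) * B^-1 `^ (1 - th))).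
    have E (D s : R) : 0 < D -> D `^ s * D^-1 `^ s = 1.
      by move=> D0; rewrite -powRM ?invr_ge0 ?ltW// mulfV ?gt_eqF// powR1.
    rewrite (_ : C * _ = f x `^ th * g x `^ (1 - th) * (A `^ th * A^-1 `^ th)
      * (B `^ (1 - th) * B^-1 `^ (1 - th))); last by rewrite /C; ring.
    by rewrite !E// !mulr1.
  apply: le_trans (ler_wpM2l (ltW C0) H) _.
  by rewrite le_eqVlt; apply/orP; left; apply/eqP; ring.
rewrite iintD ?iintZ//; last first.
- by move=> x; rewrite mulr_ge0.
- by move=> x; rewrite mulr_ge0.
- exact: mZ.
- exact: mZ.
apply: (@le_trans _ _ ((C * th / A)%:E * A%:E + (C * (1 - th) / B)%:E * B%:E)%E).
  by apply: leeD; apply: lee_wpmul2l => //; rewrite lee_fin.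
rewrite -!EFinM -EFinD lee_fin !mulfVK ?gt_eqF//.
by rewrite -mulrDr addrC subrK mulr1.
Qed.

Lemma measurable_iint_slice k (f : 'rV[R]_k.+1 -> R) :
  bmeas f -> (forall x, 0 <= f x) ->
  measurable_fun setT (fun t : R => iint (fun y : 'rV[R]_k => f (row_mx (t%:M : 'rV[R]_1) y))).
Proof.
move=> mf f0; have [d [T [nu [dec [mdec H]]]]] := @iint_rep R k.
rewrite (_ : (fun t => _) = fubini_F nu
  (fun z : measurableTypeR R * T => (f (row_mx (z.1%:M : 'rV[R]_1) (dec z.2)))%:E)).
  apply: measurable_fun_fubini_tonelli_F.
  - apply/measurable_EFinP; apply: mf; apply: row_mx_measurable.
      exact: measurable_fst.
    by move=> i; apply: (measurableT_comp (mdec i)); exact: measurable_snd.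
  - by move=> z; rewrite lee_fin.
by apply/funext => t; rewrite H//; exact: bmeas_slice.
Qed.

(** Integrates only the first coordinate, the one that [iint] integrates last; the result is the
    factor that does not depend on the slice in the induction on the dimension. *)
Definition lint k (g : 'rV[R]_k.+1 -> R) (y : 'rV[R]_k) : \bar R :=
  (\int[mu]_s (g (row_mx (s%:M : 'rV[R]_1) y))%:E)%E.

Lemma measurable_lint k (g : 'rV[R]_k.+1 -> R) d (T : measurableType d)
    (h : T -> 'rV[R]_k) :
  bmeas g -> (forall x, 0 <= g x) ->
  (forall i, measurable_fun setT (fun t => h t 0 i)) ->
  measurable_fun setT (fun t => lint g (h t)).
Proof.
move=> mg g0 mh.
apply: (@measurable_fun_fubini_tonelli_F _ _ _ _ _ mu
  (fun z : T * measurableTypeR R => (g (row_mx (z.2%:M : 'rV[R]_1) (h z.1)))%:E)).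
- apply/measurable_EFinP; apply: mg; apply: row_mx_measurable.
    exact: measurable_snd.
  by move=> i; apply: (measurableT_comp (mh i)); exact: measurable_fst.
- by move=> z; rewrite lee_fin.
Qed.

Lemma bmeas_lint k (g : 'rV[R]_k.+1 -> R) : bmeas g -> (forall x, 0 <= g x) ->
  bmeas (fun y => fine (lint g y)).
Proof.
move=> mg g0 d T h mh; apply: measurableT_comp; first exact: fine_measurable.
exact: measurable_lint.
Qed.

(** Tonelli with the first coordinate integrated first; finiteness of the line integrals ensures
    that [fine] loses nothing. *)
Lemma iint_lint k (g : 'rV[R]_k.+1 -> R) : bmeas g -> (forall x, 0 <= g x) ->
  (forall y, (lint g y < +oo)%E) ->
  iint (fun y => fine (lint g y)) = iint g.
Proof.
move=> mg g0 gfin.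
have lint0 y : (0 <= lint g y)%E by apply: integral_ge0 => s _; rewrite lee_fin.
have [d [T [nu [dec [mdec H]]]]] := @iint_rep R k.
rewrite H; [|exact: bmeas_lint|by move=> y; exact: fine_ge0].
under eq_integral => y _ do rewrite fineK ?ge0_fin_numE//.
rewrite [RHS]/=.
under [RHS]eq_integral => t _.
  rewrite H; [over|exact: bmeas_slice|by []].
pose G := fun z : measurableTypeR R * T => (g (row_mx (z.1%:M : 'rV[R]_1) (dec z.2)))%:E.
have mG : measurable_fun setT G.
  apply/measurable_EFinP; apply: mg; apply: row_mx_measurable.
    exact: measurable_fst.
  by move=> i; apply: (measurableT_comp (mdec i)); exact: measurable_snd.
have G0 z : (0 <= G z)%E by rewrite lee_fin.
have := @fubini_tonelli1 _ _ _ _ _ mu nu G mG G0.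
by rewrite (@fubini_tonelli2 _ _ _ _ _ mu nu G mG G0).
Qed.

Lemma iint_prod k (f : 'I_k -> R -> R) :
  (forall i, measurable_fun setT (f i)) -> (forall i t, 0 <= f i t) ->
  (forall i, (\int[mu]_t (f i t)%:E < +oo)%E) ->
  iint (fun x : 'rV[R]_k => \prod_i f i (x 0 i)) =
  (\prod_i fine (\int[mu]_t (f i t)%:E)%E)%:E.
Proof.
elim: k f => [|k IH] f mf f0 ff; first by rewrite /= !big_ord0.
rewrite /= big_ord_recl.
have I0 i : (0 <= \int[mu]_t (f i t)%:E)%E.
  by apply: integral_ge0 => t _; rewrite lee_fin.
rewrite (_ : (fun t => _) = (fun t => ((\prod_(i < k)
    fine (\int[mu]_t (f (lift ord0 i) t)%:E)%E)%:E * (f ord0 t)%:E)%E)).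
  rewrite ge0_integralZl//.
  - by rewrite EFinM muleC fineK// ge0_fin_numE.
  - by apply/measurable_EFinP; exact: mf.
  - by move=> t _; rewrite lee_fin.
  - by rewrite lee_fin; apply: prodr_ge0 => i _; exact: fine_ge0.
apply/funext => t.
have -> : (fun y : 'rV[R]_k => \prod_i f i (row_mx (t%:M : 'rV[R]_1) y 0 i)) =
  (fun y => f ord0 t * \prod_(i < k) f (lift ord0 i) (y 0 i)).
  apply/funext => y; rewrite big_ord_recl row_mx_coord0; congr (_ * _).
  by apply: eq_bigr => i _; rewrite row_mx_coordS.
rewrite iintZ//; first by rewrite (IH (fun i => f (lift ord0 i)))// muleC.
- move=> d T h mh; apply: measurable_prod => i _.
  by apply: measurableT_comp => //; exact: mh.
- by move=> x; apply: prodr_ge0.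
Qed.

End IteratedIntegral.

(** * The L^1 inequality of Gagliardo, Nirenberg and Sobolev *)

Section GagliardoNirenbergSobolev.
Variable R : realType.
Local Notation mu := (@lebesgue_measure R).

Definition upd k (x : 'rV[R]_k) (i : 'I_k) (s : R) : 'rV[R]_k :=
  \row_j (if j == i then s else x 0 j).

Lemma upd_row_mx0 k (t s : R) (y : 'rV[R]_k) :
  upd (row_mx (t%:M : 'rV[R]_1) y : 'rV[R]_k.+1) ord0 s = row_mx (s%:M : 'rV[R]_1) y.
Proof.
apply/rowP => j; rewrite mxE.
have [->|[i ->]] : j = ord0 \/ exists i, j = lift ord0 i.
  by case: (unliftP ord0 j) => [i ->|->]; [right; exists i|left].
- by rewrite eqxx; apply/esym; exact: row_mx_coord0.
- rewrite eq_sym (negbTE (neq_lift _ _)).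
  by apply: etrans (row_mx_coordS _ _ _) (esym (row_mx_coordS _ _ _)).
Qed.

Lemma upd_row_mxS k (t s : R) (y : 'rV[R]_k) (i : 'I_k) :
  upd (row_mx (t%:M : 'rV[R]_1) y : 'rV[R]_k.+1) (lift ord0 i) s =
  row_mx (t%:M : 'rV[R]_1) (upd y i s).
Proof.
apply/rowP => j; rewrite mxE.
have [->|[l ->]] : j = ord0 \/ exists l, j = lift ord0 l.
  by case: (unliftP ord0 j) => [l ->|->]; [right; exists l|left].
- rewrite (negbTE (neq_lift _ _)).
  by apply: etrans (row_mx_coord0 _ _) (esym (row_mx_coord0 _ _)).
- rewrite (inj_eq (@lift_inj _ _)); apply/esym.
  apply: etrans (row_mx_coordS _ _ _) _; rewrite mxE; case: ifP => // _.
  by apply/esym; exact: row_mx_coordS.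
Qed.

(* The factor [A `^ k^-1] comes from integrating out the first variable, the
   factor [c] from the inequality in the remaining [k] variables. *)
Lemma iint_powR_slices k (u g : 'rV[R]_k.+1 -> R) (A e : R) :
  (0 < k)%N -> bmeas u -> bmeas g -> (forall x, 0 <= g x) ->
  0 < A -> (iint g <= A%:E)%E ->
  (forall t c, 0 < c ->
    (iint (fun y : 'rV[R]_k => g (row_mx (t%:M : 'rV[R]_1) y)) <= c%:E)%E ->
    (iint (fun y : 'rV[R]_k => u (row_mx (t%:M : 'rV[R]_1) y) `^ e)%R <=
      (c * A `^ k%:R^-1)%:E)%E) ->
  (iint (fun x => u x `^ e)%R <= (A `^ (k.+1%:R / k%:R))%:E)%E.
Proof.
move=> k0 mu_ mg g0 A0 gA H.
set B := A `^ k%:R^-1; have B0 : 0 < B by rewrite powR_gt0.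
have -> : A `^ (k.+1%:R / k%:R) = B * A.
  rewrite -natr1 mulrDl mulfV ?pnatr_eq0 -?lt0n// mul1r powRD; last first.
    by rewrite gt_eqF ?implybT//; apply/implyP => _; rewrite gt_eqF.
  by rewrite powRr1 ?ltW// mulrC.
have pw t : (iint (fun y : 'rV[R]_k => u (row_mx (t%:M : 'rV[R]_1) y) `^ e)%R <=
   B%:E * iint (fun y : 'rV[R]_k => g (row_mx (t%:M : 'rV[R]_1) y)))%E.
  have J0 : (0 <= iint (fun y : 'rV[R]_k => g (row_mx (t%:M : 'rV[R]_1) y)))%E.
    exact: iint_ge0.
  (* [H] wants a positive real bound, but the slice integral may be 0 or infinite: in the infinite
     case the right-hand side is infinite too, in the finite case the bound is enlarged by
     [eps / B]. *)
  have := H t; move: J0; case: (iint (fun y => g _)) => [r| |] // r0 Ht; last first.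
    by rewrite mulry gtr0_sg// mul1e leey.
  apply/lee_addgt0Pr => eps eps0.
  rewrite lee_fin in r0.
  have eB : 0 < eps / B by rewrite divr_gt0.
  have -> : (B%:E * r%:E + eps%:E = ((r + eps / B) * B)%:E)%E.
    by rewrite mulrDl mulfVK ?gt_eqF// EFinD EFinM muleC.
  by apply: Ht; [rewrite ltr_wpDl|rewrite lee_fin lerDl ltW].
apply: (@le_trans _ _ (B%:E * iint g)%E); last first.
  by rewrite EFinM lee_wpmul2l// lee_fin ltW.
rewrite [iint g]/= -ge0_integralZl//; last 3 first.
- exact: measurable_iint_slice.
- by move=> t _; apply: iint_ge0.
- by rewrite lee_fin ltW.
apply: ge0_le_integral => //.
- by move=> t _; apply: iint_ge0 => y; exact: powR_ge0.
- apply: (@measurable_iint_slice R k (fun x => u x `^ e)); first exact: bmeas_powR.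
  by move=> x; exact: powR_ge0.
- by apply: measurable_funeM; exact: measurable_iint_slice.
Qed.

Lemma bmeas_upd k (g : 'rV[R]_k -> R) (x : 'rV[R]_k) i :
  bmeas g -> measurable_fun setT (fun s => g (upd x i s)).
Proof.
move=> mg; apply: (mg _ (measurableTypeR R) (fun s => upd x i s)) => j.
under eq_fun do rewrite mxE.
by case: (j == i); [exact: measurable_id|exact: measurable_cst].
Qed.

(** Induction on the dimension. On a slice of dimension [k], the power [1 + 1 / k] of [u] is split:
    the [1 / k] part is bounded by the line integral across the slices, the other factor is
    controlled by the inductive bound, and Hölder joins them. The gradient is replaced by any
    density [g] that dominates [u] along all coordinate lines, because this hypothesis passes to
    slices. *)
Lemma gns m (u g : 'rV[R]_m.+2 -> R) (A : R) :
  bmeas u -> bmeas g -> (forall x, 0 <= u x) -> (forall x, 0 <= g x) ->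
  (forall i x, (\int[mu]_s (g (upd x i s))%:E < +oo)%E) ->
  (forall i x, ((u x)%:E <= \int[mu]_s (g (upd x i s))%:E)%E) ->
  0 < A -> (iint g <= A%:E)%E ->
  (iint (fun x => u x `^ (m.+2%:R / m.+1%:R))%R <= (A `^ (m.+2%:R / m.+1%:R))%:E)%E.
Proof.
elim: m u g A => [|m IH] u g A mu_ mg u0 g0 gfin ug A0 gA.
all: apply: (iint_powR_slices _ mu_ mg g0 A0 gA) => // t c c0 gc.
all: have lintE k (f : 'rV[R]_k.+1 -> R) y : lint f y =
    (\int[mu]_s (f (upd (row_mx (t%:M : 'rV[R]_1) y) ord0 s))%:E)%E
  by rewrite /lint; apply: eq_integral => s _; rewrite upd_row_mx0.
all: have lfin y : (lint g y < +oo)%E by rewrite lintE; exact: gfin.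
all: have l0 y : (0 <= lint g y)%E by apply: integral_ge0 => s _; rewrite lee_fin.
all: have ul y : u (row_mx (t%:M : 'rV[R]_1) y) <= fine (lint g y)
  by rewrite -lee_fin fineK ?ge0_fin_numE// lintE; exact: ug.
all: have fl0 y : 0 <= fine (lint g y) by exact: fine_ge0.
(* Dimension 2: one factor of [u ^ 2] is bounded by the line integral within the slice, hence by
   [c], the other by the line integral across the slices. *)
- rewrite invr1 (powRr1 (ltW A0)) mulr1.
  apply: (@le_trans _ _ (iint (fun y => c * fine (lint g y)))); last first.
    rewrite (iintZ (ltW c0) (bmeas_lint mg g0) fl0).
    by rewrite iint_lint// EFinM lee_wpmul2l// lee_fin ltW.
  apply: le_iint.
  + by apply: bmeas_powR; exact: bmeas_slice.
  + by apply: bmeasM; [exact: bmeas_cst|exact: bmeas_lint].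
  + by move=> y; exact: powR_ge0.
  move=> y; rewrite powR_mulrn// expr2 ler_pM//.
  rewrite -lee_fin; apply: le_trans gc.
  apply: le_trans (ug (lift ord0 ord0) _) _ => /=.
  rewrite le_eqVlt; apply/orP; left; apply/eqP; apply: eq_integral => s _.
  rewrite upd_row_mxS.
  have -> // : upd y ord0 s = row_mx (s%:M : 'rV[R]_1) (0 : 'rV[R]_0).
  apply/rowP => i; rewrite (ord1 i) [LHS]mxE eqxx; apply/esym.
  exact: row_mx_coord0.
- set k := m.+2; set e1 : R := m.+2%:R / m.+1%:R.
  (* The inverse of [e1], so that the inductive bound [c ^ e1] enters Hölder's inequality as exactly
     [c], while [lint g] receives the power [1 / k]. *)
  set th : R := m.+1%:R / m.+2%:R.
  have th1 : 1 - th = k%:R^-1.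
    rewrite /th /k -[X in X - _](@divff _ (m.+2%:R : R)) ?pnatr_eq0//.
    by rewrite -mulrBl -natrB// subSnn mul1r.
  have e1th : e1 * th = 1 by rewrite /e1 /th mulrA divfK ?divff ?pnatr_eq0.
  have th01 : 0 < th < 1.
    by rewrite divr_gt0 ?ltr0n//= ltr_pdivrMr ?ltr0n// mul1r ltr_nat.
  have h1 := IH (fun y => u (row_mx (t%:M : 'rV[R]_1) y))
    (fun y => g (row_mx (t%:M : 'rV[R]_1) y)) c (bmeas_slice _ mu_) (bmeas_slice _ mg)
    (fun y => u0 _) (fun y => g0 _).
  have {}h1 : (iint (fun y : 'rV[R]_m.+2 => u (row_mx (t%:M : 'rV[R]_1) y) `^ e1)%R <= (c `^ e1)%:E)%E.
    apply: h1 => //.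
      by move=> i x; have := gfin (lift ord0 i) (row_mx (t%:M : 'rV[R]_1) x);
        under eq_integral do rewrite upd_row_mxS.
    by move=> i x; have := ug (lift ord0 i) (row_mx (t%:M : 'rV[R]_1) x);
        under eq_integral do rewrite upd_row_mxS.
  have h2 : (iint (fun y => fine (lint g y)) <= A%:E)%E by rewrite iint_lint.
  have := iint_hoelder (bmeas_powR e1 (bmeas_slice t mu_)) (bmeas_lint mg g0)
    (fun x => powR_ge0 _ _) fl0 th01 (powR_gt0 e1 c0) A0 h1 h2.
  rewrite -powRrM e1th (powRr1 (ltW c0)) th1.
  apply: le_trans; apply: le_iint.
  + by apply: bmeas_powR; exact: bmeas_slice.
  + apply: bmeasM; last by apply: bmeas_powR; exact: bmeas_lint.
    by do 2 apply: bmeas_powR; exact: bmeas_slice.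
  + by move=> y; exact: powR_ge0.
  move=> y; rewrite -powRrM e1th powRr1//.
  rewrite -natr1 mulrDl mulfV ?pnatr_eq0// mul1r powRD; last first.
    by apply/implyP; rewrite gt_eqF// ltr_pwDl// invr_ge0.
  rewrite powRr1// ler_wpM2l// ge0_ler_powR// ?nnegrE ?invr_ge0//.
Qed.

End GagliardoNirenbergSobolev.

(** * Differentiating powers of the absolute value *)

Section PowerFTC.
Variable R : realType.
Local Notation mu := (@lebesgue_measure R).

Lemma normr_powR_sqr (y c : R) : `|y| `^ c = (y ^+ 2) `^ (c / 2).
Proof.
rewrite -real_normK ?num_real// -powR_mulrn// -powRrM.
by congr (_ `^ _); field.
Qed.

Lemma is_derive_sqr_powR_neq0 (c y : R) : y != 0 ->
  is_derive y 1 (fun z => (z ^+ 2) `^ c) (2 * c * (y ^+ 2) `^ (c - 1) * y).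
Proof.
move=> y0; have y20 : 0 < y ^+ 2 by rewrite exprn_even_gt0.
have h1 : is_derive y 1 (fun z : R => z ^+ 2) (2 * y).
  split; first exact: exprn_derivable.
  by rewrite exp_derive /GRing.scale/= mulr1 expr1.
have h := @is_derive1_comp R (fun z => z `^ c) (fun z => z ^+ 2) y _ _ (is_derive1_powR c y20) h1.
by apply: is_derive_eq h _; ring.
Qed.

Lemma sqr_powR_le1 (c z : R) : 0 <= c -> `|z| <= 1 -> (z ^+ 2) `^ c <= 1.
Proof.
move=> c0 z1; have -> : 1 = 1 `^ c :> R by rewrite powR1.
rewrite ge0_ler_powR// ?nnegrE ?sqr_ge0//.
by rewrite -real_normK ?num_real// exprn_ile1.
Qed.

(** At 0 the difference quotient is at most [|h|] in absolute value once [|h| <= 1], because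
    [1 <= c] gives [(h ^ 2) ^ c <= h ^ 2]. *)
Lemma is_derive_sqr_powR (c y : R) : 1 <= c ->
  is_derive y 1 (fun z => (z ^+ 2) `^ c) (2 * c * (y ^+ 2) `^ (c - 1) * y).
Proof.
move=> c1; have [->|y0] := eqVneq y 0; last exact: is_derive_sqr_powR_neq0.
rewrite mulr0.
have H : h^-1 *: (((fun z : R => (z ^+ 2) `^ c) \o shift 0) (h *: 1) - (0 ^+ 2) `^ c)
    @[h --> (0 : R)^'] --> (0 : R).
  apply/cvgr0Pnorm_le => e e0; near=> h.
  rewrite /= addr0 expr0n/= powR0 ?gt_eqF ?(lt_le_trans _ c1)// subr0.
  rewrite /GRing.scale/= mulr1 normrM normfV ger0_norm ?powR_ge0//.
  have h0 : h != 0 by near: h; exact: nbhs_dnbhs_neq.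
  have hn0 : 0 < `|h| by rewrite normr_gt0.
  have he : `|h| <= Num.min e 1.
    near: h; apply: dnbhs0_le.
    by rewrite lt_min e0/=.
  move: he; rewrite le_min => /andP[he h1].
  rewrite ler_pdivrMl//.
  have h2 : (h ^+ 2) `^ c <= h ^+ 2.
    apply: ge1r_powR => //; apply/andP; split; first by rewrite exprn_even_gt0.
    by rewrite -real_normK ?num_real// exprn_ile1.
  apply: le_trans h2 _; rewrite -real_normK ?num_real// expr2 ler_wpM2l//.
split; first by apply/cvg_ex; exists 0.
exact: cvg_lim H.
Unshelve. all: by end_near. Qed.

Lemma continuous_sqr_powRM (c : R) : 0 <= c ->
  continuous (fun y : R => (y ^+ 2) `^ c * y).
Proof.
move=> c0 y; have [->|y0] := eqVneq y 0.
  rewrite /continuous_at mulr0; apply/cvgr0Pnorm_le => e e0; near=> z.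
  have : `|z| <= Num.min e 1.
    by near: z; apply: (@nbhs0_le R R); rewrite lt_min e0/=.
  rewrite le_min => /andP[ze z1]; rewrite normrM ger0_norm ?powR_ge0//.
  apply: le_trans ze; rewrite ler_piMl// sqr_powR_le1//.
apply: cvgM; last exact: cvg_id.
have [h _] := is_derive_sqr_powR_neq0 c y0.
exact: (@differentiable_continuous _ _ _ _ (fun z : R => (z ^+ 2) `^ c) ((derivable1_diffP _ _).1 h)).
Unshelve. all: by end_near. Qed.

(** The fundamental theorem of calculus is applied to [(psi ^ 2) ^ (c / 2)], which equals |psi|^c
    and, as [1 <= c / 2], is continuously differentiable even at the zeros of [psi]; the integral
    over [[a, b]] is then enlarged to the whole line. *)
Lemma powR_ftc_bound (psi dpsi : R -> R) (c a b : R) : 2 <= c -> a < b ->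
  (forall s : R, is_derive s 1 psi (dpsi s)) -> continuous dpsi -> psi a = 0 ->
  ((`|psi b| `^ c)%:E <= \int[mu]_s (c * `|psi s| `^ (c - 1) * `|dpsi s|)%:E)%E.
Proof.
move=> c2 ab dP cd pa.
have c1 : 1 <= c / 2 by lra.
have c0 : 0 <= c / 2 - 1 by lra.
have cpsi : continuous psi.
  by move=> s; have [h _] := dP s; apply: differentiable_continuous; exact/derivable1_diffP.
pose F s := (psi s ^+ 2) `^ (c / 2).
pose f s := c * ((psi s ^+ 2) `^ (c / 2 - 1) * psi s) * dpsi s.
have cf : continuous f.
  move=> s; apply: cvgM; last exact: cd.
  apply: cvgM; first exact: cvg_cst.
  apply: (@continuous_comp _ _ _ psi (fun y => (y ^+ 2) `^ (c / 2 - 1) * y)).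
    exact: cpsi.
  exact: continuous_sqr_powRM.
have dF (s : R) : is_derive s 1 F (f s).
  have h := @is_derive1_comp R (fun z => (z ^+ 2) `^ (c / 2)) psi s _ _
    (is_derive_sqr_powR (psi s) c1) (dP s).
  by apply: is_derive_eq h _; rewrite /f; field.
have cF : continuous F.
  by move=> s; have [h _] := dF s; apply: differentiable_continuous; exact/derivable1_diffP.
have FTC : (\int[mu]_(x in `[a, b]) (f x)%:E = (F b)%:E - (F a)%:E)%E.
  apply: continuous_FTC2 => //.
  - exact: continuous_subspaceT.
  - split; first by move=> s _; have [] := dF s.
      by apply: cvg_at_right_filter; exact: cF.
    by apply: cvg_at_left_filter; exact: cF.
  - by move=> s _; rewrite derive1E; have [_ ->] := dF s.
have fE s : `|f s| = c * `|psi s| `^ (c - 1) * `|dpsi s|.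
  rewrite /f !normrM; congr (_ * _); rewrite (@ger0_norm _ c); last by lra.
  congr (_ * _); rewrite ger0_norm ?powR_ge0//.
  rewrite (_ : c / 2 - 1 = (c - 2) / 2); last by field.
  rewrite -normr_powR_sqr.
  have [->|p0] := eqVneq (psi s) 0.
    by rewrite normr0 mulr0 powR0// gt_eqF//; lra.
  rewrite -[X in _ * X]powRr1// -powRD; last by rewrite normr_eq0 p0 implybT.
  by congr (_ `^ _); ring.
have mf (D : set R) : measurable D -> measurable_fun D (EFin \o f).
  move=> mD; apply/measurable_EFinP; apply: measurable_funTS.
  exact: continuous_measurable_fun.
have -> : `|psi b| `^ c = F b by rewrite normr_powR_sqr.
have Fa : F a = 0 by rewrite /F pa expr0n/= powR0// gt_eqF//; lra.
rewrite (_ : (F b)%:E = `|\int[mu]_(x in `[a, b]) (f x)%:E|%E); last first.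
  by rewrite FTC Fa sube0 abse_EFin ger0_norm// powR_ge0.
apply: le_trans (le_abse_integral mu _ _) _ => //.
  exact: mf.
under [X in (_ <= X)%E]eq_integral do rewrite -fE.
apply: ge0_subset_integral => //.
apply/measurable_EFinP/measurableT_comp => //.
exact: continuous_measurable_fun.
Qed.

End PowerFTC.

(** * Bounds, supports and line integrals of test functions *)

Section TestFunctions.
Variables (R : realType) (N : nat).
Local Notation mu := (@lebesgue_measure R).
Implicit Types (Om : set 'rV[R]_N) (phi : 'rV[R]_N -> R).

Lemma testfun_continuous Om phi : testfun Om phi -> continuous phi.
Proof. by move=> [sm _] x; exact: differentiable_continuous (sm [::] x). Qed.

Lemma testfun_partial_continuous Om phi i : testfun Om phi -> continuous (partial i phi).
Proof. by move=> [sm _] x; exact: differentiable_continuous (sm [:: i] x). Qed.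

Lemma testfun_bmeas Om phi : testfun Om phi -> bmeas phi.
Proof. by move=> t; apply: continuous_bmeas; exact: testfun_continuous t. Qed.

Lemma testfun_partial_bmeas Om phi i : testfun Om phi -> bmeas (partial i phi).
Proof. by move=> t; apply: continuous_bmeas; exact: testfun_partial_continuous t. Qed.

Lemma partial_eq0_near i phi (x : 'rV[R]_N) : (\forall y \near x, phi y = 0) -> partial i phi x = 0.
Proof.
move=> h; rewrite /partial.
by rewrite (@near_eq_derive _ _ _ _ (cst 0) _ _ h) derive_cst.
Qed.

Lemma testfun_supp Om phi : testfun Om phi ->
  exists K : set 'rV[R]_N, [/\ compact K, K `<=` Om &
   forall x, ~ K x -> phi x = 0 /\ forall i, partial i phi x = 0].
Proof.
move=> [sm [K [cK KO z]]]; exists K; split=> // x Kx; split; first exact: z.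
move=> i; apply: partial_eq0_near.
have oK : open (~` K) by apply: closed_openC; exact: compact_closed.
by apply: filterS (open_nbhs_nbhs (conj oK Kx)) => y; exact: z.
Qed.

Lemma testfun_outside Om phi : testfun Om phi -> forall x, ~ Om x ->
  phi x = 0 /\ forall i, partial i phi x = 0.
Proof. by move=> /testfun_supp[K [_ KO z]] x Ox; apply: z => /KO. Qed.

Lemma coord_le_norm (x : 'rV[R]_N) i : `|x 0 i| <= `|x|.
Proof.
rewrite [leRHS]/Num.norm/= mx_normrE.
exact: (le_bigmax _ (fun ij : 'I_1 * 'I_N => `|x ij.1 ij.2|) (0, i)).
Qed.

Lemma testfun_bounds Om phi : testfun Om phi -> exists M L : R,
  [/\ 0 < M, 0 < L,
   forall x, `|phi x| <= M /\ forall i, `|partial i phi x| <= M &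
   forall (x : 'rV[R]_N) i, L < `|x 0 i| -> phi x = 0 /\ forall j, partial j phi x = 0].
Proof.
move=> t; have [K [cK KO z]] := testfun_supp t.
have cb (f : 'rV[R]_N -> R) : continuous f -> (forall x, ~ K x -> f x = 0) ->
    exists2 M, 0 < M & forall x, `|f x| <= M.
  move=> cf f0; have /compact_bounded[M [_ HM]] : compact (f @` K).
    by apply: continuous_compact => //; exact: continuous_subspaceT.
  exists (`|M| + 1); first by rewrite ltr_wpDl.
  move=> x; have [Kx|Kx] := pselect (K x).
    by apply: (HM (`|M| + 1)); [rewrite ltr_pwDr// ler_norm|exists x].
  by rewrite f0// normr0 addr_ge0.
have [M0 M00 h0] := cb _ (testfun_continuous t) (fun x Kx => (z x Kx).1).
have H i : exists M, 0 < M /\ forall x, `|partial i phi x| <= M.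
  have [M1 ? ?] := cb _ (@testfun_partial_continuous _ _ i t) (fun x Kx => (z x Kx).2 i).
  by exists M1.
have [Mi hi] := choice H.
have [L [_ HL]] := compact_bounded cK.
exists (M0 + \sum_i Mi i), (`|L| + 1); split.
- by rewrite ltr_pwDl// sumr_ge0// => i _; have [/ltW] := hi i.
- by rewrite ltr_wpDl.
- move=> x; split.
    by apply: le_trans (h0 x) _; rewrite lerDl sumr_ge0// => i _; have [/ltW] := hi i.
  move=> i; apply: le_trans ((hi i).2 x) _; rewrite (bigD1 i)//= addrCA lerDl.
  apply: addr_ge0; first exact: ltW.
  by apply: sumr_ge0 => j _; exact: ltW (hi j).1.
- move=> x i Lx; apply: z => Kx.
  have := HL (`|L| + 1) ltac:(by rewrite ltr_pwDr// ler_norm) x Kx.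
  by rewrite /= leNgt (lt_le_trans Lx)// coord_le_norm.
Qed.

(** [M] times the indicator of the cube of half-side [L] is a majorant, and its integral
    factorizes. *)
Lemma iint_bounded_support_fin (f : 'rV[R]_N -> R) (M L : R) : bmeas f ->
  (forall x, 0 <= f x <= M) -> (forall (x : 'rV[R]_N) i, L < `|x 0 i| -> f x = 0) ->
  (iint f < +oo)%E.
Proof.
move=> mf f0M fL.
have M0 : 0 <= M by have /andP[h1 h2] := f0M 0; exact: le_trans h1 h2.
pose b (i : 'I_N) (t : R) : R := \1_(`[- L, L]%classic) t.
have mb i : measurable_fun setT (b i) by exact: measurable_indic.
have b0 i t : 0 <= b i t by [].
have bfin i : (\int[mu]_t (b i t)%:E < +oo)%E.
  rewrite /b integral_indic// setIT.
  by have := lebesgue_measure_itv (R := R) `[- L, L]; rewrite /= => ->; case: ifP => _; rewrite -?EFinD ltry.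
have mprod : bmeas (fun x : 'rV[R]_N => \prod_i b i (x 0 i)).
  move=> d T h mh; apply: measurable_prod => i _.
  by apply: measurableT_comp => //; exact: mh.
apply: (@le_lt_trans _ _ (iint (fun x => M * \prod_i b i (x 0 i)))).
  apply: le_iint => //.
  - by apply: bmeasM => //; exact: bmeas_cst.
  - by move=> x; have /andP[] := f0M x.
  move=> x; have [/existsP[i Li]|] := boolP [exists i, L < `|x 0 i|].
    by rewrite (fL _ _ Li) mulr_ge0// prodr_ge0.
  rewrite negb_exists => /forallP h; rewrite big1 ?mulr1; first by have /andP[] := f0M x.
  move=> i _; rewrite /b indicE mem_set//= in_itv/= -ler_norml leNgt; exact: h.
rewrite iintZ//; last by move=> x; exact: prodr_ge0.
by rewrite iint_prod// -EFinM ltry.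
Qed.

Lemma line_bounded_support_fin (f : 'rV[R]_N -> R) (M L : R) i x : bmeas f ->
  (forall x, 0 <= f x <= M) -> (forall (x : 'rV[R]_N) i, L < `|x 0 i| -> f x = 0) ->
  (\int[mu]_s (f (upd x i s))%:E < +oo)%E.
Proof.
move=> mf f0M fL.
have M0 : 0 <= M by have /andP[h1 h2] := f0M 0; exact: le_trans h1 h2.
apply: (@le_lt_trans _ _ (\int[mu]_s (M%:E * (\1_(`[- L, L]%classic) s)%:E))%E).
  apply: ge0_le_integral => //.
  - by move=> s _; rewrite lee_fin; have /andP[] := f0M (upd x i s).
  - by apply/measurable_EFinP; exact: bmeas_upd.
  - apply: measurable_funeM; apply/measurable_EFinP; exact: measurable_indic.
  move=> s _; rewrite -EFinM lee_fin indicE.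
  have [Ls|Ls] := ltP L `|s|.
    by rewrite (fL _ i) ?mulr_ge0// mxE eqxx.
  rewrite mem_set//= ?in_itv/= -?ler_norml// mulr1.
  by have /andP[] := f0M (upd x i s).
rewrite ge0_integralZl//; last by apply/measurable_EFinP; exact: measurable_indic.
rewrite integral_indic// setIT.
have := lebesgue_measure_itv (R := R) `[- L, L]; rewrite /= => ->; case: ifP => _.
  by rewrite -EFinD -EFinM ltry.
by rewrite mule0 ltry.
Qed.

Lemma is_derive_upd Om phi (x : 'rV[R]_N) i (s : R) : testfun Om phi ->
  is_derive s 1 (fun s => phi (upd x i s)) (partial i phi (upd x i s)).
Proof.
move=> [sm _].
have E : (fun h : R => h^-1 *: (((fun s => phi (upd x i s)) \o shift s) (h *: 1) - phi (upd x i s)))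
  = (fun h : R => h^-1 *: ((phi \o shift (upd x i s)) (h *: evec R i) - phi (upd x i s))).
  apply/funext => h /=; congr (_ *: (phi _ - _)).
  apply/rowP => j; rewrite !mxE eqxx/=.
  case: (j == i); first by [].
  by rewrite mulr0 add0r.
have dv : derivable phi (upd x i s) (evec R i) by exact: diff_derivable (sm [::] _).
split; first by rewrite /derivable E.
by rewrite /derive E.
Qed.

Lemma testfun_line_bound Om phi (c : R) (x : 'rV[R]_N) i : testfun Om phi -> 2 <= c ->
  ((`|phi x| `^ c)%:E <=
    \int[mu]_s (c * `|phi (upd x i s)| `^ (c - 1) * `|partial i phi (upd x i s)|)%:E)%E.
Proof.
move=> t c2; have [M [L [M0 L0 _ z]]] := testfun_bounds t.
have xE : x = upd x i (x 0 i).
  by apply/rowP => j; rewrite mxE; case: eqP => [->|].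
rewrite [in leLHS]xE.
have cu : continuous (upd x i).
  move=> s; apply/cvgrPdist_lt => e e0; near=> s'.
  rewrite [ltLHS]/Num.norm/= mx_normrE; apply/bigmax_ltP; split=> // -[a j] _ /=.
  rewrite !mxE; case: (j == i); last by rewrite subrr normr0.
  by near: s'; exact: cvgr_dist_lt.
(* The integration starts at a point that is both to the left of [x 0 i] and outside the support. *)
apply: (@powR_ftc_bound R (fun s => phi (upd x i s)) (fun s => partial i phi (upd x i s))
  c (- (L + `|x 0 i| + 1)) (x 0 i) c2).
- have := ler_norm (- x 0 i); rewrite normrN; lra.
- by move=> s; exact: is_derive_upd t.
- move=> s; apply: (@continuous_comp _ _ _ (upd x i) (partial i phi)); first exact: cu.
  exact: (@testfun_partial_continuous _ _ i t).
- apply: (z _ i _).1; rewrite mxE eqxx normrN ger0_norm; have := normr_ge0 (x 0 i); lra.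
Unshelve. all: by end_near. Qed.

End TestFunctions.

(** * The L^1 inequality for powers of a test function *)

Section GagliardoNirenbergTest.
Variable R : realType.
Local Notation mu := (@lebesgue_measure R).

Definition gradphi N (phi : 'rV[R]_N -> R) : 'I_N -> 'rV[R]_N -> R :=
  fun i => partial i phi.

Lemma gradsq_ge0 N (g : 'I_N -> 'rV[R]_N -> R) x : 0 <= gradsq g x.
Proof. by apply: sumr_ge0 => i _; exact: sqr_ge0. Qed.

Lemma norm_le_gradsq N (g : 'I_N -> 'rV[R]_N -> R) i x :
  `|g i x| <= gradsq g x `^ 2^-1.
Proof.
rewrite powR12_sqrt ?gradsq_ge0// -sqrtr_sqr ler_wsqrtr//.
by rewrite /gradsq (bigD1 i)//= lerDl; apply: sumr_ge0 => j _; exact: sqr_ge0.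
Qed.

Lemma testfun_gradsq_bmeas N (Om : set 'rV[R]_N) phi :
  testfun Om phi -> bmeas (gradsq (gradphi phi)).
Proof. by move=> t; apply: bmeas_gradsq => i; exact: testfun_partial_bmeas t. Qed.

(** The length of the gradient of |phi|^c: one density that dominates the partial derivatives in all
    directions, as [gns] requires. *)
Definition gdens N (c : R) (phi : 'rV[R]_N -> R) (x : 'rV[R]_N) : R :=
  c * (`|phi x| `^ (c - 1) * gradsq (gradphi phi) x `^ 2^-1).

Lemma gdens_ge0 N (c : R) (phi : 'rV[R]_N -> R) x : 0 <= c -> 0 <= gdens c phi x.
Proof. by move=> c0; rewrite !mulr_ge0 ?powR_ge0. Qed.

Lemma gdens_bmeas N (Om : set 'rV[R]_N) c phi : testfun Om phi -> bmeas (gdens c phi).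
Proof.
move=> t; apply: bmeasM; first exact: bmeas_cst.
apply: bmeasM; apply: bmeas_powR; last exact: testfun_gradsq_bmeas t.
by apply: bmeas_norm; exact: testfun_bmeas t.
Qed.

Lemma testfun_powR_fin N (Om : set 'rV[R]_N) c phi : 0 < c ->
  testfun Om phi -> (iint (fun x => `|phi x| `^ c)%R < +oo)%E.
Proof.
move=> c0 t; have [M [L [M0 L0 b z]]] := testfun_bounds t.
apply: (@iint_bounded_support_fin _ _ _ (M `^ c) L).
- by apply: bmeas_powR; apply: bmeas_norm; exact: testfun_bmeas t.
- move=> x; rewrite powR_ge0 ge0_ler_powR ?nnegrE ?(ltW c0) ?(ltW M0)//.
  exact: (b x).1.
- by move=> x i /z[-> _]; rewrite normr0 powR0// gt_eqF.
Qed.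

Lemma testfun_gradsq_bounds N (Om : set 'rV[R]_N) phi : testfun Om phi ->
  exists M L : R, (forall x, gradsq (gradphi phi) x <= M) /\
   forall (x : 'rV[R]_N) i, L < `|x 0 i| -> gradsq (gradphi phi) x = 0.
Proof.
move=> t; have [M [L [M0 L0 b z]]] := testfun_bounds t.
exists (\sum_(i < N) M ^+ 2), L; split.
  move=> x; apply: ler_sum => i _.
  by rewrite -real_normK ?num_real// lerXn2r ?nnegrE ?(ltW M0)//; exact: (b x).2.
move=> x i /z[_ h]; apply: big1 => j _; rewrite /gradphi h expr0n//.
Qed.

Lemma testfun_gradsq_fin N (Om : set 'rV[R]_N) phi :
  testfun Om phi -> (iint (gradsq (gradphi phi)) < +oo)%E.
Proof.
move=> t; have [M [L [b z]]] := testfun_gradsq_bounds t.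
apply: (@iint_bounded_support_fin _ _ _ M L) => //; first exact: testfun_gradsq_bmeas t.
by move=> x; rewrite gradsq_ge0 b.
Qed.

Lemma gdens_line_fin N (Om : set 'rV[R]_N) c phi x i : 1 < c -> testfun Om phi ->
  (\int[mu]_s (gdens c phi (upd x i s))%:E < +oo)%E.
Proof.
move=> c1 t; have [M [L [M0 L0 b z]]] := testfun_bounds t.
have [M' [_ [b' _]]] := testfun_gradsq_bounds t.
have M'0 : 0 <= M' by apply: le_trans (b' 0); exact: gradsq_ge0.
have c0 : 0 <= c - 1 by lra.
apply: (@line_bounded_support_fin _ _ _ (c * (M `^ (c - 1) * M' `^ 2^-1)) L).
- exact: gdens_bmeas t.
- move=> y; rewrite gdens_ge0/=; last by lra.
  apply: ler_wpM2l; first by lra.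
  rewrite ler_pM ?powR_ge0// ge0_ler_powR ?nnegrE ?gradsq_ge0 ?invr_ge0 ?(ltW M0)//.
  exact: (b y).1.
- by move=> y j /z[h _]; rewrite /gdens h normr0 powR0 ?mul0r ?mulr0// gt_eqF//; lra.
Qed.

Lemma gdens_line_bound N (Om : set 'rV[R]_N) c phi x i : 2 <= c -> testfun Om phi ->
  ((`|phi x| `^ c)%:E <= \int[mu]_s (gdens c phi (upd x i s))%:E)%E.
Proof.
move=> c2 t; apply: le_trans (testfun_line_bound x i t c2) _.
have c0 : 0 <= c by lra.
apply: ge0_le_integral => //.
- by move=> s _; rewrite lee_fin !mulr_ge0 ?powR_ge0.
- apply/measurable_EFinP.
  apply: (@bmeas_upd _ _ (fun y => c * `|phi y| `^ (c - 1) * `|partial i phi y|)).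
  apply: bmeasM; last by apply: bmeas_norm; exact: testfun_partial_bmeas t.
  apply: bmeasM; first exact: bmeas_cst.
  by apply: bmeas_powR; apply: bmeas_norm; exact: testfun_bmeas t.
- by apply/measurable_EFinP; apply: bmeas_upd; exact: gdens_bmeas t.
- move=> s _; rewrite lee_fin -mulrA ler_wpM2l// ler_wpM2l ?powR_ge0//.
  exact: (@norm_le_gradsq _ (gradphi phi)).
Qed.

(** Cauchy-Schwarz, with |phi|^(c-1) read as the square root of |phi|^(2c-2). *)
Lemma gdens_hoelder N (Om : set 'rV[R]_N) c phi (P G : R) : 2 <= c -> testfun Om phi ->
  0 < P -> 0 < G -> (iint (fun x => `|phi x| `^ (2 * c - 2))%R <= P%:E)%E ->
  (iint (gradsq (gradphi phi)) <= G%:E)%E ->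
  (iint (gdens c phi) <= (c * (P `^ 2^-1 * G `^ 2^-1))%:E)%E.
Proof.
move=> c2 t P0 G0 hP hG; have c0 : 0 <= c by lra.
have mp : bmeas (fun x => `|phi x| `^ (2 * c - 2)).
  by apply: bmeas_powR; apply: bmeas_norm; exact: testfun_bmeas t.
have mg := testfun_gradsq_bmeas t.
have := iint_hoelder mp mg (fun=> powR_ge0 _ _) (@gradsq_ge0 N _)
  (_ : 0 < 2^-1 < 1) P0 G0 hP hG.
have -> : 1 - 2^-1 = 2^-1 :> R by field.
move=> /(_ ltac:(lra)) h.
have E : gdens c phi = fun x => c * ((`|phi x| `^ (2 * c - 2)) `^ 2^-1
    * gradsq (gradphi phi) x `^ 2^-1).
  apply/funext => x; rewrite /gdens -powRrM; congr (_ * (_ `^ _ * _)).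
  by field.
rewrite E iintZ//; last 2 first.
- by apply: bmeasM; exact: bmeas_powR.
- by move=> x; rewrite mulr_ge0 ?powR_ge0.
by rewrite EFinM lee_wpmul2l.
Qed.

Lemma testfun_gns m (Om : set 'rV[R]_m.+2) c phi (A : R) : 2 <= c -> testfun Om phi ->
  0 < A -> (iint (gdens c phi) <= A%:E)%E ->
  (iint (fun x => `|phi x| `^ (c * (m.+2%:R / m.+1%:R)))%R
    <= (A `^ (m.+2%:R / m.+1%:R))%:E)%E.
Proof.
move=> c2 t A0 hA.
under [X in (iint X <= _)%E]funext do rewrite powRrM.
apply: (gns (u := fun x => `|phi x| `^ c) (g := gdens c phi)) => //.
- by apply: bmeas_powR; apply: bmeas_norm; exact: testfun_bmeas t.
- exact: gdens_bmeas t.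
- by move=> x; apply: gdens_ge0; lra.
- by move=> i x; apply: gdens_line_fin t; lra.
- by move=> i x; exact: gdens_line_bound t.
Qed.

(* Solves the self-improving estimate [Q <= (c Q^(th/2) ...)^e] for [Q]. *)
Lemma powR_absorb (Q K ka : R) : 0 < Q -> 0 <= K -> 0 < ka ->
  Q <= K * Q `^ (1 - ka) -> Q <= K `^ ka^-1.
Proof.
move=> Q0 K0 ka0 h.
have : Q `^ ka <= K.
  rewrite -(ler_pM2r (powR_gt0 (1 - ka) Q0)) -powRD; last first.
    by rewrite (gt_eqF Q0) implybT.
  by rewrite addrC subrK powRr1// ltW.
move=> /(@ge0_ler_powR R ka^-1) h2.
have := h2 _ _ _; rewrite -powRrM mulfV ?gt_eqF// powRr1 ?(ltW Q0)//; apply => //.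
- by rewrite invr_ge0 ltW.
- by rewrite nnegrE powR_ge0.
Qed.

Lemma powR_absorb_le (Q K ka C : R) : 0 <= Q -> 0 <= K -> 0 < ka ->
  (0 < Q -> Q <= K * Q `^ (1 - ka)) -> K `^ ka^-1 <= C -> Q <= C.
Proof.
rewrite le_eqVlt => /predU1P[<- _ _ _|Q0 K0 ka0 h]; first by move=> /(le_trans (powR_ge0 _ _)).
by apply: le_trans; apply: powR_absorb => //; exact: h.
Qed.

End GagliardoNirenbergTest.

(** * The Gagliardo-Nirenberg inequality for test functions *)

Section GagliardoNirenbergInequality.
Variable R : realType.
Local Notation mu := (@lebesgue_measure R).

Lemma iint1_upd (f : 'rV[R]_1 -> R) x :
  iint f = (\int[mu]_s (f (upd x ord0 s))%:E)%E.
Proof.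
apply: eq_integral => s _ /=; congr (f _)%:E.
apply/rowP => i; rewrite (ord1 i) [RHS]mxE eqxx; exact: row_mx_coord0.
Qed.

(** The value [th = 1] is included because it occurs at the critical exponent; there [c = q] and no
    Hölder inequality is involved. *)
Lemma testfun_interp N (Om : set 'rV[R]_N) phi (q c th Q rho : R) :
  testfun Om phi -> 0 < c -> 0 < th <= 1 -> c = q * th + 2 * (1 - th) ->
  0 < Q -> 0 < rho ->
  (iint (fun x => `|phi x| `^ q)%R <= Q%:E)%E ->
  (iint (fun x => phi x ^+ 2)%R <= rho%:E)%E ->
  (iint (fun x => `|phi x| `^ c)%R <= (Q `^ th * rho `^ (1 - th))%:E)%E.
Proof.
move=> t c0 /andP[th0]; rewrite le_eqVlt => /predU1P[->|th1] cE Q0 rho0 hQ hr.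
  rewrite subrr powRr0 mulr1 powRr1 ?(ltW Q0)// (_ : c = q)//.
  by rewrite cE subrr mulr0 addr0 mulr1.
have mphi := testfun_bmeas t.
have := iint_hoelder (bmeas_powR q (bmeas_norm mphi)) (bmeasX 2 mphi)
  (fun=> powR_ge0 _ _) (fun=> sqr_ge0 _) (_ : 0 < th < 1) Q0 rho0 hQ hr.
rewrite th0 th1 => /(_ isT).
rewrite (_ : (fun x => _) = (fun x => `|phi x| `^ c)%R)//.
apply/funext => x; rewrite -real_normK ?num_real// -powR_mulrn// -!powRrM -powRD ?cE//.
by rewrite -cE gt_eqF.
Qed.

(** Here [k] is N - 1 and [q] is p + 1. The number [th] solves [2 c - 2 = q th + 2 (1 - th)], so
    [2 < c] makes it positive, and [th <= 1] is the Sobolev restriction on [q]. *)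
Lemma gn_exponents (k q c th : R) : 1 <= k -> 2 + 4 / (k + 1) < q ->
  q * (k - 1) <= 2 * (k + 1) ->
  c = q * k / (k + 1) -> th = (2 * c - 4) / (q - 2) ->
  [/\ 2 < q, 2 < c & 0 < th <= 1].
Proof.
move=> k1 hq hk cE thE.
have d0 : 0 < k + 1 by lra.
have qd : 2 * (k + 1) + 4 < q * (k + 1).
  by move: hq; rewrite -(ltr_pM2r d0) mulrDl mulfVK ?gt_eqF.
have q2 : 2 < q by rewrite -(ltr_pM2r d0); lra.
have c2 : 2 < c by rewrite cE ltr_pdivlMr//; nra.
split=> //; rewrite thE divr_gt0 ?subr_gt0//=; last by lra.
rewrite ler_pdivrMr ?subr_gt0// mul1r.
have : 2 * c <= q + 2; last by lra.
by rewrite cE mulrA ler_pdivrMr//; lra.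
Qed.

Lemma gn_testfun (n : nat) (q : R) : 2 + 4 / n.+1%:R < q ->
  ((2 < n.+1)%N -> q <= 2 * n.+1%:R / (n.+1%:R - 2)) ->
  exists2 C : R, 0 < C & forall (Om : set 'rV[R]_n.+1) phi (rho G : R),
    testfun Om phi -> 0 < rho -> 0 < G ->
    (iint (fun x => phi x ^+ 2)%R <= rho%:E)%E ->
    (iint (gradsq (gradphi phi)) <= G%:E)%E ->
    (iint (fun x => `|phi x| `^ q)%R <=
     (C * G `^ (n.+1%:R * (q - 2) / 4) * rho `^ (q / 2 - n.+1%:R * (q - 2) / 4))%:E)%E.
Proof.
case: n => [|m] hq hcrit.
  (* Dimension 1: the line bound with exponent 2 gives [phi ^ 2 <= 2 sqrt (rho G)] everywhere; this
     handles [q - 2] of the powers, and the mass handles the last two. *)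
  have q2 : 2 < q by move: hq; rewrite divr1; lra.
  exists (2 `^ ((q - 2) / 2)); first by rewrite powR_gt0.
  move=> Om phi rho G t rho0 G0 hr hG.
  have h1 : (iint (gdens 2 phi) <= (2 * (rho `^ 2^-1 * G `^ 2^-1))%:E)%E.
    apply: gdens_hoelder t rho0 G0 _ hG => //.
    rewrite (_ : (fun x => _) = (fun x => phi x ^+ 2)%R)//.
    apply/funext => x; rewrite (_ : 2 * 2 - 2 = 2%:R); last by ring.
    by rewrite powR_mulrn// real_normK ?num_real.
  set B := 2 * (rho `^ 2^-1 * G `^ 2^-1) in h1.
  have sup x : phi x ^+ 2 <= B.
    rewrite -lee_fin; apply: le_trans h1.
    rewrite -real_normK ?num_real// -powR_mulrn//.
    by rewrite (iint1_upd _ x); exact: gdens_line_bound t.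
  have B0 : 0 < B by rewrite !mulr_gt0 ?powR_gt0.
  have mphi := testfun_bmeas t.
  apply: (@le_trans _ _ (iint (fun x => B `^ ((q - 2) / 2) * phi x ^+ 2))).
    apply: le_iint.
    - by apply: bmeas_powR; exact: bmeas_norm.
    - by apply: bmeasM; [exact: bmeas_cst|exact: bmeasX].
    - by move=> x; exact: powR_ge0.
    move=> x; rewrite (_ : q = (q - 2) + 2%:R); last by ring.
    rewrite powRD; last by rewrite gt_eqF//; lra.
    rewrite powR_mulrn// real_normK ?num_real// ler_wpM2r ?sqr_ge0//.
    rewrite normr_powR_sqr (_ : q - 2 + 2%:R - 2 = q - 2); last by ring.
    by apply: ge0_ler_powR; rewrite ?nnegrE ?sqr_ge0 ?(ltW B0)//; lra.
  rewrite iintZ ?powR_ge0//; last 2 first.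
  - exact: bmeasX.
  - by move=> x; exact: sqr_ge0.
  apply: le_trans (lee_wpmul2l _ hr) _; first by rewrite lee_fin powR_ge0.
  rewrite -EFinM lee_fin /B !powRM ?powR_ge0// ?mulr_ge0 ?powR_ge0//.
  rewrite -!powRrM -!mulrA ler_wpM2l ?powR_ge0// mulrCA mulrC.
  rewrite -[X in _ * X * _]powRr1 ?(ltW rho0)//.
  rewrite le_eqVlt; apply/orP; left; apply/eqP.
  rewrite -powRD; last by rewrite (gt_eqF rho0) implybT.
  by rewrite mulrC; congr (_ `^ _ * _ `^ _); field.
pose k : R := m.+1%:R; pose c := q * k / (k + 1); pose th := (2 * c - 4) / (q - 2).
have NE : m.+2%:R = k + 1 :> R by rewrite natr1.
have k1 : 1 <= k by rewrite ler1n.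
rewrite NE in hq hcrit *.
have hk : q * (k - 1) <= 2 * (k + 1).
  case: m @k NE k1 hq hcrit @c @th => [|m] k NE k1 hq hcrit c th.
    by rewrite /k subrr mulr0; lra.
  have k2 : 0 < k - 1 by rewrite subr_gt0 /k ltr1n.
  have := hcrit isT; rewrite (_ : k + 1 - 2 = k - 1); last by ring.
  by rewrite ler_pdivlMr.
have [q2 c2 th01] := gn_exponents k1 hq hk (erefl c) (erefl th).
have /andP[th0 th1] := th01.
have kE : m.+1%:R = k :> R by [].
have cE : c = q * k / (k + 1) by [].
have thE : th = (2 * c - 4) / (q - 2) by [].
clearbody th c k.
have k0 : k != 0 by rewrite gt_eqF//; lra.
have d0 : k + 1 != 0 by rewrite gt_eqF//; lra.
have q20 : q - 2 != 0 by rewrite gt_eqF//; lra.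
pose e := (k + 1) / k.
(* Chosen so that [1 - ka = th * e / 2], the power of [Q] left on the right-hand side. *)
pose ka := 2 / (k * (q - 2)).
have e0 : 0 < e by rewrite divr_gt0//; lra.
have ka0 : 0 < ka by rewrite divr_gt0 ?mulr_gt0//; lra.
exists ((c `^ e) `^ ka^-1); first by rewrite !powR_gt0//; lra.
move=> Om phi rho G t rho0 G0 hr hG.
have Qfin : (iint (fun x => `|phi x| `^ q)%R < +oo)%E.
  by apply: testfun_powR_fin t; lra.
have Qge0 : (0 <= iint (fun x => `|phi x| `^ q)%R)%E.
  by apply: iint_ge0 => x; exact: powR_ge0.
rewrite -[leLHS]fineK ?ge0_fin_numE// lee_fin.
set Q := fine _.
have hQ : (iint (fun x => `|phi x| `^ q)%R <= Q%:E)%E by rewrite fineK ?ge0_fin_numE.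
pose K := c `^ e * (rho `^ ((1 - th) / 2 * e) * G `^ (2^-1 * e)).
apply: (@powR_absorb_le _ Q K ka) => //.
- exact: fine_ge0.
- by rewrite !mulr_ge0 ?powR_ge0.
- move=> Q0.
  have hP : (iint (fun x => `|phi x| `^ (2 * c - 2))%R
      <= (Q `^ th * rho `^ (1 - th))%:E)%E.
    apply: testfun_interp t _ th01 _ Q0 rho0 hQ hr; first by lra.
    by rewrite thE; field.
  have P0 : 0 < Q `^ th * rho `^ (1 - th) by rewrite mulr_gt0 ?powR_gt0.
  have h1 := gdens_hoelder (ltW c2) t P0 G0 hP hG.
  have A0 : 0 < c * ((Q `^ th * rho `^ (1 - th)) `^ 2^-1 * G `^ 2^-1).
    apply: mulr_gt0; first by lra.
    by apply: mulr_gt0; exact: powR_gt0.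
  have := testfun_gns (ltW c2) t A0 h1; rewrite NE kE -/e.
  rewrite (_ : c * e = q); last by rewrite cE /e; field; rewrite ?d0 ?k0 ?q20.
  rewrite -[leLHS]fineK ?ge0_fin_numE// lee_fin -/Q => h2.
  apply: le_trans h2 _; rewrite le_eqVlt; apply/orP; left; apply/eqP.
  have c0 : 0 <= c by lra.
  rewrite !powRM ?mulr_ge0 ?powR_ge0//.
  rewrite -!powRrM.
  have -> : th * (2^-1 * e) = 1 - ka.
    by rewrite thE cE /ka /e; field; rewrite ?d0 ?k0 ?q20.
  rewrite (_ : (1 - th) * (2^-1 * e) = (1 - th) / 2 * e); last by ring.
  by rewrite /K; ring.
rewrite /K !powRM ?mulr_ge0 ?powR_ge0// -!powRrM.
rewrite -!mulrA ler_wpM2l ?powR_ge0// mulrC.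
rewrite le_eqVlt; apply/orP; left; apply/eqP.
congr (_ `^ _ * _ `^ _).
  by rewrite /e /ka; field; rewrite ?d0 ?k0 ?q20.
by rewrite thE cE /e /ka; field; rewrite ?d0 ?k0 ?q20.
Qed.

End GagliardoNirenbergInequality.

(** * From test functions to their limits *)

Section Closure.
Variable R : realType.

Lemma exists_cvg0_le (f g : nat -> \bar R) (eps : R) : 0 < eps ->
  f @ \oo --> 0%E -> g @ \oo --> 0%E ->
  exists k, (f k <= eps%:E)%E /\ (g k <= eps%:E)%E.
Proof.
move=> eps0 cf cg.
have e0 : (0%E < eps%:E)%E by rewrite lte_fin.
have hf : \forall k \near \oo, (f k < eps%:E)%E := cf _ (open_ereal_lt' e0).
have hg : \forall k \near \oo, (g k < eps%:E)%E := cg _ (open_ereal_lt' e0).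
have [k _ /(_ k (leqnn k)) [h1 h2]] := filterI hf hg.
by exists k; split; exact: ltW.
Qed.

Lemma sqr_le_2sqrB (x y : R) : x ^+ 2 <= 2 * (x - y) ^+ 2 + 2 * y ^+ 2.
Proof. by have := sqr_ge0 (x - y - y); nra. Qed.

Lemma iint_le_2B N (f g h : 'rV[R]_N -> R) (A B : R) : bmeas f -> bmeas g -> bmeas h ->
  (forall x, 0 <= f x) -> (forall x, 0 <= g x) -> (forall x, 0 <= h x) ->
  (forall x, f x <= 2 * g x + 2 * h x) ->
  (iint g <= A%:E)%E -> (iint h <= B%:E)%E -> (iint f <= (2 * A + 2 * B)%:E)%E.
Proof.
move=> mf mg mh f0 g0 h0 le hA hB.
have mZ l : bmeas l -> bmeas (fun x : 'rV[R]_N => 2 * l x).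
  by move=> ml; apply: bmeasM => //; exact: bmeas_cst.
apply: (@le_trans _ _ (iint (fun x => 2 * g x + 2 * h x))).
  by apply: le_iint => //; apply: bmeasD; exact: mZ.
have z2 (x : R) : 0 <= x -> 0 <= 2 * x by move=> x0; rewrite mulr_ge0.
rewrite iintD; [|exact: mZ|exact: mZ|by move=> x; exact: z2|by move=> x; exact: z2].
rewrite !iintZ// (_ : (2 * A + 2 * B)%:E = (2%:E * A%:E + 2%:E * B%:E)%E)//.
by apply: leeD; exact: lee_wpmul2l.
Qed.

Lemma gradsq_le_2B N (g h : 'I_N -> 'rV[R]_N -> R) x :
  gradsq g x <= 2 * gradsq (fun i y => g i y - h i y) x + 2 * gradsq h x.
Proof.
rewrite /gradsq !mulr_sumr -big_split/=; apply: ler_sum => i _.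
exact: sqr_le_2sqrB.
Qed.

Lemma gradsq_distC N (g h : 'I_N -> 'rV[R]_N -> R) :
  gradsq (fun i y => g i y - h i y) = gradsq (fun i y => h i y - g i y).
Proof.
by apply/funext => x; apply: eq_bigr => i _; rewrite -sqrrN opprB.
Qed.

Lemma norm_le_2max (x y : R) : `|x| <= 2 * `|y| \/ `|x| <= 2 * `|y - x|.
Proof.
have [h|h] := lerP `|x| (2 * `|y|); [by left|right].
have := ler_normD (y - x) (- y); rewrite addrAC subrr sub0r !normrN; lra.
Qed.

Lemma powR_triangle (q x y : R) : 0 <= q ->
  `|x| `^ q <= 2 `^ q * (`|y| `^ q + `|y - x| `^ q).
Proof.
move=> q0; have [h|h] := norm_le_2max x y.
all: rewrite mulrDr -!powRM//.
all: apply: le_trans (ge0_ler_powR q0 _ _ h) _; rewrite ?nnegrE ?mulr_ge0//.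
  by rewrite lerDl powR_ge0.
by rewrite lerDr powR_ge0.
Qed.

(** Turns an L^2 error into an L^q bound. Either [|x| <= 2 |y|], or [|x| <= 2 |y - x|]; in the
    second case two powers of the minimum are estimated by [|y - x|] and the other [q - 2] by the
    height [M]. *)
Lemma min_powR_triangle (q M x y : R) : 2 <= q -> 0 < M ->
  Num.min `|x| M `^ q <= 2 `^ q * `|y| `^ q + 2 `^ q * M `^ (q - 2) * (y - x) ^+ 2.
Proof.
move=> q2 M0; have q0 : 0 <= q by lra.
have m0 : 0 <= Num.min `|x| M by rewrite le_min normr_ge0 ltW.
have mx : Num.min `|x| M <= `|x| by rewrite ge_min lexx.
have mM : Num.min `|x| M <= M by rewrite ge_min lexx orbT.
have [h|h] := norm_le_2max x y.
  apply: le_trans (ge0_ler_powR q0 _ _ (le_trans mx h)) _; rewrite ?nnegrE ?mulr_ge0//.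
  rewrite powRM// lerDl; apply: mulr_ge0; last exact: sqr_ge0.
  by rewrite mulr_ge0 ?powR_ge0.
have E : Num.min `|x| M `^ q = Num.min `|x| M `^ (q - 2) * Num.min `|x| M ^+ 2.
  rewrite -powR_mulrn// -powRD subrK//.
  have q00 : 0 < q by lra.
  by rewrite (gt_eqF q00).
rewrite E.
have h2 : Num.min `|x| M ^+ 2 <= 2 `^ q * (y - x) ^+ 2.
  apply: (@le_trans _ _ (2 ^+ 2 * (y - x) ^+ 2)).
    rewrite -[(y - x) ^+ 2]real_normK ?num_real// -exprMn lerXn2r ?nnegrE ?mulr_ge0//.
    exact: le_trans h.
  by rewrite ler_wpM2r ?sqr_ge0// -powR_mulrn// ler_powR// ler1n.
have h3 : Num.min `|x| M `^ (q - 2) <= M `^ (q - 2).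
  by rewrite ge0_ler_powR ?nnegrE ?(ltW M0)//; lra.
apply: le_trans (ler_pM _ _ h3 h2) _; rewrite ?powR_ge0 ?sqr_ge0//.
by rewrite mulrCA mulrA lerDr mulr_ge0 ?powR_ge0.
Qed.

Lemma iint_powR_le_of_min N (u : 'rV[R]_N -> R) (q : R) (c : \bar R) : bmeas u -> 0 <= q ->
  (forall M : R, 0 < M -> (iint (fun x => Num.min `|u x| M `^ q)%R <= c)%E) ->
  (iint (fun x => `|u x| `^ q)%R <= c)%E.
Proof.
move=> mu_ q0 h.
apply: (@iint_le_of_nd_seq R N (fun n x => Num.min `|u x| n.+1%:R `^ q)).
- by move=> n; apply: bmeas_powR; apply: bmeas_min; [exact: bmeas_norm|exact: bmeas_cst].
- by apply: bmeas_powR; exact: bmeas_norm.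
- by move=> n x; exact: powR_ge0.
- move=> x m n mn.
  have z k : Num.min `|u x| k.+1%:R \is Num.nneg by rewrite nnegrE le_min normr_ge0/=.
  apply: ge0_ler_powR => //; rewrite le_min !ge_min lexx/=; apply/orP; right.
  by rewrite ler_nat ltnS.
- move=> x; near=> n; congr (_ `^ _); apply/min_idPl.
  apply: le_trans (ltW (archi_boundP (normr_ge0 (u x)))) _.
  rewrite ler_nat; apply: leqW; near: n; exact: nbhs_infty_ge.
- by move=> n; apply: h; rewrite ltr0n.
Unshelve. all: by end_near. Qed.

Lemma gn_closure (n : nat) (q : R) : 2 + 4 / n.+1%:R < q ->
  ((2 < n.+1)%N -> q <= 2 * n.+1%:R / (n.+1%:R - 2)) ->
  exists2 C : R, 0 < C & forall (Om : set 'rV[R]_n.+1) u g (rho G : R),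
    bmeas u -> (forall i, bmeas (g i)) ->
    (forall eps : R, 0 < eps -> exists phi, [/\ testfun Om phi,
      (iint (fun x => (phi x - u x) ^+ 2)%R <= eps%:E)%E &
      (iint (gradsq (fun i x => partial i phi x - g i x)%R) <= eps%:E)%E]) ->
    0 <= rho -> 0 < G ->
    (iint (fun x => u x ^+ 2)%R <= rho%:E)%E ->
    (iint (gradsq g) <= G%:E)%E ->
    (iint (fun x => `|u x| `^ q)%R <=
     (C * G `^ (n.+1%:R * (q - 2) / 4) * rho `^ (q / 2 - n.+1%:R * (q - 2) / 4))%:E)%E.
Proof.
move=> hq hcrit; have [C C0 HC] := gn_testfun hq hcrit.
have q2 : 2 < q by apply: lt_trans hq; rewrite ltrDl divr_gt0 ?ltr0n.
set a := n.+1%:R * (q - 2) / 4 in HC *.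
set s := q / 2 - a in HC *.
(* The factors 4 come from the bounds [4 * rho] and [4 * G] for the approximating test function, the
   summand 1 from the error of approximation. *)
exists (2 `^ q * (C * 4 `^ a * 4 `^ s + 1)).
  by rewrite mulr_gt0 ?powR_gt0// ltr_wpDl// !mulr_ge0 ?powR_ge0 ?(ltW C0).
move=> Om u g rho G mu_ mg happ rho0 G0 hr hG.
have RHS0 : 0 <= 2 `^ q * (C * 4 `^ a * 4 `^ s + 1) * G `^ a * rho `^ s.
  by rewrite !mulr_ge0 ?powR_ge0// addr_ge0// !mulr_ge0 ?powR_ge0// ltW.
apply: iint_powR_le_of_min => //; first by lra.
move=> M M0.
have mmin : bmeas (fun x => Num.min `|u x| M `^ q).
  by apply: bmeas_powR; apply: bmeas_min; [exact: bmeas_norm|exact: bmeas_cst].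
have K0 : 0 < 2 `^ q * M `^ (q - 2) by rewrite mulr_gt0 ?powR_gt0.
have min0 x : 0 <= Num.min `|u x| M `^ q by exact: powR_ge0.
(* For [rho = 0] the comparison function is 0: the truncated power is then at most a multiple of
   [u ^ 2], whose integral vanishes. *)
move: rho0; rewrite le_eqVlt => /predU1P[rhoE|rho0].
  apply: (@le_trans _ _ 0%E); last by rewrite lee_fin.
  apply: (@le_trans _ _ (iint (fun x => 2 `^ q * M `^ (q - 2) * u x ^+ 2))).
    apply: le_iint => //.
      by apply: bmeasM; [exact: bmeas_cst|exact: bmeasX].
    move=> x; apply: le_trans (min_powR_triangle (u x) 0 (ltW q2) M0) _.
    by rewrite normr0 powR0 ?mulr0 ?add0r ?sub0r ?sqrrN// gt_eqF//; lra.
  rewrite iintZ//; last 3 first.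
  - exact: ltW.
  - exact: bmeasX.
  - by move=> x; exact: sqr_ge0.
  rewrite -[leRHS](mule0 (2 `^ q * M `^ (q - 2))%:E) lee_wpmul2l ?lee_fin ?(ltW K0)//.
  by move: hr; rewrite -rhoE.
pose eta := G `^ a * rho `^ s.
have eta0 : 0 < eta by rewrite mulr_gt0 ?powR_gt0.
(* The last entry cancels the factor [M ^ (q - 2)] of [min_powR_triangle], so the final bound is
   uniform in [M]. *)
pose eps := Num.min (Num.min rho G) (eta / M `^ (q - 2)).
have eps0 : 0 < eps by rewrite !lt_min rho0 G0 divr_gt0 ?powR_gt0.
have [phi [t h1 h2]] := happ _ eps0.
have e1 : eps <= rho by rewrite !ge_min lexx.
have e2 : eps <= G by rewrite !ge_min lexx orbT.
have e3 : eps <= eta / M `^ (q - 2) by rewrite !ge_min lexx orbT.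
have mphi := testfun_bmeas t.
have hr' : (iint (fun x => phi x ^+ 2)%R <= (4 * rho)%:E)%E.
  have := iint_le_2B (bmeasX 2 mphi) (bmeasX 2 (bmeasB mphi mu_)) (bmeasX 2 mu_)
    (fun=> sqr_ge0 _) (fun=> sqr_ge0 _) (fun=> sqr_ge0 _) (fun=> sqr_le_2sqrB _ _) h1 hr.
  by move=> /le_trans; apply; rewrite lee_fin; lra.
have hG' : (iint (gradsq (gradphi phi)) <= (4 * G)%:E)%E.
  have mB : bmeas (gradsq (fun i x => partial i phi x - g i x)).
    by apply: bmeas_gradsq => i; apply: bmeasB => //; exact: testfun_partial_bmeas t.
  have := iint_le_2B (testfun_gradsq_bmeas t) mB (bmeas_gradsq mg)
    (@gradsq_ge0 _ _ _) (@gradsq_ge0 _ _ _) (@gradsq_ge0 _ _ _)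
    (fun x => gradsq_le_2B (gradphi phi) g x) h2 hG.
  by move=> /le_trans; apply; rewrite lee_fin; lra.
have := HC Om phi _ _ t _ _ hr' hG'; rewrite !mulr_gt0// => /(_ isT isT) hQ.
apply: (@le_trans _ _ (iint (fun x => 2 `^ q * `|phi x| `^ q +
    2 `^ q * M `^ (q - 2) * (phi x - u x) ^+ 2))).
  apply: le_iint => //.
    apply: bmeasD; apply: bmeasM; try exact: bmeas_cst.
      by apply: bmeas_powR; exact: bmeas_norm.
    by apply: bmeasX; exact: bmeasB.
  by move=> x; apply: min_powR_triangle => //; exact: ltW.
rewrite iintD; last 4 first.
- by apply: bmeasM; [exact: bmeas_cst|apply: bmeas_powR; exact: bmeas_norm].
- by apply: bmeasM; [exact: bmeas_cst|apply: bmeasX; exact: bmeasB].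
- by move=> x; rewrite mulr_ge0 ?powR_ge0.
- by move=> x; rewrite mulr_ge0 ?sqr_ge0// ltW.
rewrite (iintZ (powR_ge0 2 q) (bmeas_powR q (bmeas_norm mphi)) (fun=> powR_ge0 _ _)).
rewrite (iintZ (ltW K0) (bmeasX 2 (bmeasB mphi mu_)) (fun=> sqr_ge0 _)).
apply: (@le_trans _ _ ((2 `^ q)%:E * (C * (4 * G) `^ a * (4 * rho) `^ s)%:E +
   (2 `^ q * M `^ (q - 2))%:E * eps%:E)%E).
  by apply: leeD; apply: lee_wpmul2l; rewrite ?lee_fin ?powR_ge0 ?(ltW K0).
rewrite -!EFinM -EFinD lee_fin.
have -> : 2 `^ q * (C * 4 `^ a * 4 `^ s + 1) * G `^ a * rho `^ s =
  2 `^ q * (C * (4 * G) `^ a * (4 * rho) `^ s) + 2 `^ q * eta.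
  by rewrite !powRM ?(ltW G0) ?(ltW rho0)// /eta; ring.
rewrite lerD2l -mulrA ler_wpM2l ?powR_ge0//.
by rewrite mulrC -ler_pdivlMr ?powR_gt0.
Qed.

End Closure.

(** * Gagliardo-Nirenberg on H^1_0 and Sobolev on D^{1,2} *)

Section SobolevInequalities.
Variable R : realType.

Lemma indicK N (Om : set 'rV[R]_N) x m : (0 < m)%N -> (\1_Om x : R) ^+ m = \1_Om x.
Proof. by move=> m0; rewrite indicE; case: (_ \in _); rewrite ?expr1n// expr0n gtn_eqF. Qed.

Lemma gn_H10 (n : nat) (q : R) : 2 + 4 / n.+1%:R < q ->
  ((2 < n.+1)%N -> q <= 2 * n.+1%:R / (n.+1%:R - 2)) ->
  exists2 C : R, 0 < C & forall (Om : set 'rV[R]_n.+1) u g (rho G : R),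
    open Om -> H10 Om u g -> 0 <= rho -> 0 < G ->
    (L2sq Om u <= rho%:E)%E -> (Dsq Om g <= G%:E)%E ->
    (intO Om (fun x => `|u x| `^ q)%R <=
     (C * G `^ (n.+1%:R * (q - 2) / 4) * rho `^ (q / 2 - n.+1%:R * (q - 2) / 4))%:E)%E.
Proof.
move=> hq hcrit; have [C C0 HC] := gn_closure hq hcrit.
have q0 : q != 0 by rewrite gt_eqF// (lt_trans _ hq)// ltr_wpDr// divr_ge0.
exists C => // Om u g rho G oO [bu [bg [phi [tphi cu cg]]]] rho0 G0 hr hG.
have mO := bmeas_indic (R := R) oO.
have mu_ := borel_fun_bmeas bu.
have mg i := borel_fun_bmeas (bg i).
(* [L2sq] and [Dsq] see only [Om], whereas the closure lemma integrates over the whole space.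
   Cutting off reconciles them, and cannot increase the approximation errors since test functions
   vanish outside [Om]. *)
pose u' x := \1_Om x * u x; pose g' i x := \1_Om x * g i x.
have mu' : bmeas u' by exact: bmeasM.
have mg' i : bmeas (g' i) by exact: bmeasM.
have -> : intO Om (fun x => `|u x| `^ q) = iint (fun x => `|u' x| `^ q).
  rewrite /intO; congr iint; apply/funext => x; rewrite /u' indicE.
  by case: (_ \in _); rewrite ?mul1r// !mul0r normr0 powR0.
apply: (HC Om u' g') => //.
- move=> eps eps0; have [k [h1 h2]] := exists_cvg0_le eps0 cu cg.
  exists (phi k); split=> //.
  + apply: le_trans h1; apply: le_iint.
    * by apply: bmeasX; apply: bmeasB => //; exact: testfun_bmeas (tphi k).
    * by apply: bmeasX; apply: bmeasB => //; exact: testfun_bmeas (tphi k).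
    * by move=> x; exact: sqr_ge0.
    move=> x; rewrite /u' indicE; have [xO|xO] := boolP (x \in Om).
      by rewrite mul1r.
    rewrite (testfun_outside (tphi k) _).1; last by move=> /mem_set; exact/negP.
    by rewrite mul0r subrr expr0n/= sqr_ge0.
  + apply: le_trans h2; apply: le_iint.
    * by apply: bmeas_gradsq => i; apply: bmeasB => //; exact: testfun_partial_bmeas (tphi k).
    * by apply: bmeas_gradsq => i; apply: bmeasB => //; exact: testfun_partial_bmeas (tphi k).
    * by move=> x; exact: gradsq_ge0.
    move=> x; apply: ler_sum => i _; rewrite /g' indicE; have [xO|xO] := boolP (x \in Om).
      by rewrite mul1r.
    rewrite (testfun_outside (tphi k) _).2; last by move=> /mem_set; exact/negP.
    by rewrite mul0r subrr expr0n/= sqr_ge0.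
- rewrite (_ : (fun x => _) = (fun x => \1_Om x * u x ^+ 2)%R)//.
  by apply/funext => x; rewrite exprMn indicK.
- rewrite (_ : gradsq g' = (fun x => \1_Om x * gradsq g x)%R)//.
  apply/funext => x; rewrite /gradsq mulr_sumr; apply: eq_bigr => i _.
  by rewrite exprMn indicK.
Qed.

Lemma crit_exp_gt2 (N : nat) : (2 < N)%N -> 2 < @crit_exp R N.
Proof.
move=> N2; have N2R : 2 < N%:R :> R by rewrite ltr_nat.
by rewrite /crit_exp ltr_pdivlMr; lra.
Qed.

(** At the critical exponent the power of the mass in [gn_testfun] is 0, so the inequality survives
    in D^{1,2}, where no L^2 norm is at hand. It shows that the set defining [sobolev_const] is
    nonempty. *)
Lemma sobolev_inequality (n : nat) (q := @crit_exp R n.+1) : (2 < n.+1)%N ->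
  exists2 S : R, 0 < S & forall (v : 'rV[R]_n.+1 -> R) g, D12 q v g ->
    (iint (gradsq g) < +oo)%E /\
    (iint (fun x => `|v x| `^ q)%R <= (S * (fine (iint (gradsq g))) `^ (q / 2))%:E)%E.
Proof.
move=> N2; have N2R : 2 < n.+1%:R :> R by rewrite ltr_nat.
have N20 : n.+1%:R - 2 != 0 :> R by rewrite gt_eqF// subr_gt0.
have N0 : n.+1%:R != 0 :> R by rewrite pnatr_eq0.
have q2 : 2 < q by exact: crit_exp_gt2.
have hq : 2 + 4 / n.+1%:R < q.
  rewrite /q /crit_exp ltr_pdivlMr ?subr_gt0//.
  rewrite (_ : (2 + 4 / n.+1%:R) * (n.+1%:R - 2) = 2 * n.+1%:R - 8 / n.+1%:R).
    by rewrite gtrBl divr_gt0 ?ltr0n.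
  by field.
have [C C0 HC] := gn_testfun hq (fun=> lexx _).
have aE : n.+1%:R * (q - 2) / 4 = q / 2.
  have aux (t : R) : t - 2 != 0 -> t * (2 * t / (t - 2) - 2) / 4 = 2 * t / (t - 2) / 2.
    by move=> t2; field.
  exact: aux.
rewrite aE subrr in HC.
have qh0 : 0 <= q / 2 by lra.
exists (2 `^ q * (C * 4 `^ (q / 2) + 1)).
  by rewrite mulr_gt0 ?powR_gt0// ltr_wpDl// mulr_ge0 ?powR_ge0 ?(ltW C0).
move=> v g [bv [bg [phi [tphi cv cg]]]].
have mv := borel_fun_bmeas bv.
have mg i := borel_fun_bmeas (bg i).
have mB k : bmeas (gradsq (fun i x => partial i (phi k) x - g i x)).
  by apply: bmeas_gradsq => i; apply: bmeasB => //; exact: testfun_partial_bmeas (tphi k).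
have Gfin : (iint (gradsq g) < +oo)%E.
  have [k [_ h2]] := exists_cvg0_le (ltr01 : 0 < 1 :> R) cv cg.
  have Gk0 : (0 <= iint (gradsq (gradphi (phi k))))%E by apply: iint_ge0; exact: gradsq_ge0.
  have : (iint (gradsq (gradphi (phi k))) <= (fine (iint (gradsq (gradphi (phi k)))))%:E)%E.
    by rewrite fineK// ge0_fin_numE//; exact: testfun_gradsq_fin (tphi k).
  move=> h3; rewrite gradsq_distC in h2; have := mB k; rewrite gradsq_distC => mBk.
  have := iint_le_2B (bmeas_gradsq mg) mBk (testfun_gradsq_bmeas (tphi k))
    (@gradsq_ge0 _ _ _) (@gradsq_ge0 _ _ _) (@gradsq_ge0 _ _ _)
    (fun x => gradsq_le_2B g (gradphi (phi k)) x) h2 h3.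
  by move=> /le_lt_trans; apply; rewrite ltry.
split=> //; set G := fine _.
have G0 : 0 <= G by apply: fine_ge0; apply: iint_ge0; exact: gradsq_ge0.
have hG : (iint (gradsq g) <= G%:E)%E.
  by rewrite fineK// ge0_fin_numE//; apply: iint_ge0; exact: gradsq_ge0.
have key eps : 0 < eps ->
  (iint (fun x => `|v x| `^ q)%R <= (2 `^ q * (C * (2 * eps + 2 * G) `^ (q / 2) + eps))%:E)%E.
  move=> eps0; have [k [h1 h2]] := exists_cvg0_le eps0 cv cg.
  have mphi := testfun_bmeas (tphi k).
  have h4 := iint_le_2B (testfun_gradsq_bmeas (tphi k)) (mB k) (bmeas_gradsq mg)
    (@gradsq_ge0 _ _ _) (@gradsq_ge0 _ _ _) (@gradsq_ge0 _ _ _)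
    (fun x => gradsq_le_2B (gradphi (phi k)) g x) h2 hG.
  have E2 : (fun x => `|phi k x| `^ 2) = (fun x => phi k x ^+ 2).
    by apply/funext => x; rewrite -[2]/(2%:R) powR_mulrn// real_normK ?num_real.
  have := testfun_powR_fin (ltr0Sn R 1) (tphi k); rewrite E2 => r1.
  have r0 : (0 <= iint (fun x => phi k x ^+ 2)%R)%E by apply: iint_ge0 => x; exact: sqr_ge0.
  (* Any positive bound on the mass serves, as it enters with the power 0. *)
  have hr : (iint (fun x => phi k x ^+ 2)%R <= (fine (iint (fun x => phi k x ^+ 2)%R) + 1)%:E)%E.
    by rewrite EFinD fineK ?ge0_fin_numE// leeDl// lee_fin.
  have e2 : 0 < 2 * eps + 2 * G by lra.
  have r2 : 0 < fine (iint (fun x => phi k x ^+ 2)%R) + 1 by rewrite ltr_wpDl ?fine_ge0.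
  have := HC _ _ _ _ (tphi k) r2 e2 hr h4; rewrite powRr0 mulr1 => hQ.
  have mvp : bmeas (fun x => `|phi k x - v x| `^ q).
    by apply: bmeas_powR; apply: bmeas_norm; exact: bmeasB.
  have mpp : bmeas (fun x => `|phi k x| `^ q) by apply: bmeas_powR; exact: bmeas_norm.
  apply: (@le_trans _ _ (iint (fun x => 2 `^ q * (`|phi k x| `^ q + `|phi k x - v x| `^ q)))).
    apply: le_iint.
    - by apply: bmeas_powR; exact: bmeas_norm.
    - by apply: bmeasM; [exact: bmeas_cst|exact: bmeasD].
    - by move=> x; exact: powR_ge0.
    - by move=> x; apply: powR_triangle; lra.
  rewrite (iintZ (powR_ge0 2 q) (bmeasD mpp mvp)); last first.
    by move=> x; rewrite addr_ge0 ?powR_ge0.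
  rewrite (iintD mpp mvp (fun=> powR_ge0 _ _) (fun=> powR_ge0 _ _)) EFinM.
  apply: lee_wpmul2l; first by rewrite lee_fin powR_ge0.
  by rewrite EFinD; exact: leeD.
(* If [G = 0], the error cannot be compared with a power of [G] and is sent to 0 instead. *)
move: G0; rewrite le_eqVlt => /predU1P[GE|G0].
  rewrite -GE powR0 ?mulr0; last by rewrite gt_eqF//; lra.
  set K := 2 `^ q * (C * 2 `^ (q / 2) + 1).
  have K0 : 0 < K by rewrite mulr_gt0 ?powR_gt0// ltr_wpDl// mulr_ge0 ?powR_ge0 ?(ltW C0).
  apply/lee_addgt0Pr => d d0; rewrite add0e.
  pose eps := Num.min 1 (d / K).
  have eps0 : 0 < eps by rewrite lt_min ltr01 divr_gt0.
  have eps1 : eps <= 1 by rewrite ge_min lexx.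
  have epsd : eps <= d / K by rewrite ge_min lexx orbT.
  apply: le_trans (key _ eps0) _; rewrite lee_fin -GE mulr0 addr0.
  apply: (@le_trans _ _ (K * eps)); last by rewrite mulrC -ler_pdivlMr.
  rewrite /K -mulrA ler_wpM2l ?powR_ge0// [leRHS]mulrDl mul1r lerD2r.
  rewrite powRM ?(ltW eps0)// mulrA ler_wpM2l ?mulr_ge0 ?powR_ge0 ?(ltW C0)//.
  by apply: ge1r_powR; rewrite ?eps0//; lra.
(* The first entry gives [2 * eps + 2 * G <= 4 * G], the second bounds the additive error by
   [G ^ (q / 2)]. *)
pose eps := Num.min G (G `^ (q / 2)).
have eps0 : 0 < eps by rewrite lt_min G0 powR_gt0.
apply: le_trans (key _ eps0) _; rewrite lee_fin -mulrA ler_wpM2l ?powR_ge0//.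
rewrite [leRHS]mulrDl mul1r lerD//; last by rewrite ge_min lexx orbT.
rewrite -mulrA ler_wpM2l ?(ltW C0)// -powRM ?(ltW G0)//.
have e1 : eps <= G by rewrite ge_min lexx.
by apply: ge0_ler_powR; rewrite ?nnegrE//; lra.
Qed.

End SobolevInequalities.

(** * Smooth functions that are flat at the origin *)

Section FlatFunctions.
Variable R : realType.

(* The derivatives of [x |-> exp (- x^-1)] (extended by [0] to [x <= 0]) are the
   products of this function with polynomials in [x^-1]. *)
Definition flat (P : {poly R}) (x : R) : R :=
  if 0 < x then P.[x^-1] * expR (- x^-1) else 0.

Lemma horner_growth (P : {poly R}) :
  exists k : nat, exists2 C : R, 0 <= C & forall y, 0 <= y -> `|P.[y]| <= C * (1 + y) ^+ k.
Proof.
elim/poly_ind: P => [|P c [k [C C0 h]]].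
  by exists 0%N, 0 => // y _; rewrite horner0 normr0 mul0r.
exists k.+1, (C + `|c|); first by rewrite addr_ge0.
move=> y y0; rewrite !hornerE; apply: le_trans (ler_normD _ _) _.
have y1 : 1 <= 1 + y by rewrite lerDl.
rewrite mulrDl; apply: lerD.
  rewrite normrM exprS mulrCA [leLHS]mulrC ler_pM//; last exact: h.
  by rewrite ger0_norm// lerDr.
by rewrite ler_peMr// exprn_ege1.
Qed.

(** With [y = 1 / x], the exponential series gives [(1 + y) ^ k.+1 <= k.+1! exp (1 + y)]. This is
    one power more than the growth of [P] requires, and the spare factor, at least [1 / x], produces
    [|x|]. *)
Lemma flat_bound (P : {poly R}) :
  exists2 C : R, 0 <= C & forall x, `|flat P x| <= C * `|x|.
Proof.
have [k [C C0 h]] := horner_growth P.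
exists (C * ((k.+1)`!%:R * expR 1)); first by rewrite !mulr_ge0 ?expR_ge0.
move=> x; rewrite /flat; case: ifPn => [x0|_]; last first.
  by rewrite normr0 !mulr_ge0 ?expR_ge0.
set y := x^-1; have y0 : 0 < y by rewrite invr_gt0.
rewrite normrM (ger0_norm (expR_ge0 _)) (gtr0_norm x0).
have y10 : 0 < 1 + y by rewrite addr_gt0.
apply: le_trans (ler_wpM2r (expR_ge0 _) (h y (ltW y0))) _.
rewrite -!mulrA ler_wpM2l//.
have E : (1 + y) ^+ k.+1 <= (k.+1)`!%:R * (expR 1 * expR y).
  rewrite -expRD mulrC -ler_pdivrMr ?ltr0n ?fact_gt0//.
  by apply: le_trans (expR_ge1Dxn k (ltW y10)); rewrite lerDr.
rewrite expRN ler_pdivrMr ?expR_gt0//.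
have xE : x = y^-1 by rewrite invrK.
apply: (@le_trans _ _ ((1 + y) ^+ k.+1 * x)).
  by rewrite exprSr -mulrA ler_peMr ?exprn_ge0 ?(ltW y10)// xE ler_pdivlMr// mul1r lerDr.
apply: le_trans (ler_wpM2r (ltW x0) E) _.
by rewrite le_eqVlt; apply/orP; left; apply/eqP; ring.
Qed.

Lemma flatX (P : {poly R}) x : x != 0 -> x^-1 * flat P x = flat ('X * P) x.
Proof.
by move=> x0; rewrite /flat; case: ifP => _; rewrite ?mulr0// hornerM hornerX mulrA.
Qed.

(** The polynomial is the chain rule in the variable [1 / x]. At 0 the quotient [flat P h / h] is
    again flat, with polynomial ['X * P], so [flat_bound] sends it to 0. *)
Lemma is_derive_flat (P : {poly R}) (x : R) :
  is_derive x 1 (flat P) (flat ('X ^+ 2 * (P - P^`())) x).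
Proof.
have [x0|x0|->] := ltgtP x 0.
- have -> : flat ('X ^+ 2 * (P - P^`())) x = 0 by rewrite /flat ltNge (ltW x0).
  have h : \forall z \near x, cst 0 z = flat P z.
    by near=> z; rewrite /flat/= ifN// -leNgt ltW//; near: z; exact: lt_nbhsl.
  apply: near_eq_is_derive h _; exact: is_derive_cst.
- have h : \forall z \near x, P.[z^-1] * expR (- z^-1) = flat P z.
    by near=> z; rewrite /flat/= ifT//; near: z; exact: lt_nbhsr.
  apply: near_eq_is_derive h _.
  have xn0 : x != 0 by rewrite gt_eqF.
  have dV : is_derive x 1 (fun z : R => z^-1) (- (x ^- 2)).
    split; first by apply: derivableV.
    by rewrite (deriveV (f := id))// derive_id /GRing.scale/= mulr1.
  have d1 := @is_derive1_comp R (horner P) (fun z => z^-1) x _ _ (is_derive_poly P _) dV.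
  have d2 := @is_derive1_comp R expR (fun z => - z^-1) x _ _ (is_derive_expR _) (is_deriveN dV).
  have d3 := is_deriveM d1 d2.
  apply: is_derive_eq d3 _.
  by rewrite /GRing.scale/= /flat x0 hornerM hornerXn hornerD hornerN; field.
- have [C C0 hC] := flat_bound ('X * P).
  have -> : flat ('X ^+ 2 * (P - P^`())) 0 = 0 by rewrite /flat ltxx.
  have H : h^-1 *: ((flat P \o shift 0) (h *: 1) - flat P 0) @[h --> (0 : R)^'] --> (0 : R).
    apply/cvgr0Pnorm_le => e e0; near=> h.
    have h0 : h != 0 by near: h; exact: nbhs_dnbhs_neq.
    rewrite /= addr0 {2}/flat ltxx subr0 /GRing.scale/= mulr1 flatX//.
    apply: le_trans (hC h) _.
    have : `|h| <= e / (C + 1).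
      by near: h; apply: dnbhs0_le; rewrite divr_gt0// ltr_wpDl.
    rewrite ler_pdivlMr ?ltr_wpDl// => hle; apply: le_trans hle.
    by rewrite mulrC ler_wpM2l// lerDl.
  split; first by apply/cvg_ex; exists 0.
  exact: cvg_lim H.
Unshelve. all: by end_near. Qed.

End FlatFunctions.

(** * Bump functions on cubes *)

Section Bump.
Variables (R : realType) (N : nat).
Local Notation V := 'rV[R]_N.

(** A class of differentiable functions that is stable under [partial]; this yields
    differentiability of all iterated partial derivatives at once. *)
Inductive flat_gen : (V -> R) -> Prop :=
| flat_gen_flat P (i : 'I_N) s c : flat_gen (fun x => flat P (s * x 0 i + c))
| flat_gen_cst c : flat_gen (fun=> c)
| flat_genD f g : flat_gen f -> flat_gen g -> flat_gen (fun x => f x + g x)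
| flat_genM f g : flat_gen f -> flat_gen g -> flat_gen (fun x => f x * g x).

Lemma is_derive_flat_affine (P : {poly R}) s c (t : R) :
  is_derive t 1 (fun t => flat P (s * t + c)) (s * flat ('X ^+ 2 * (P - P^`())) (s * t + c)).
Proof.
have d1 : is_derive t 1 (fun t : R => s * t + c) s.
  have h := is_deriveD (is_deriveZ s (is_derive_id t (1 : R))) (is_derive_cst c t 1).
  by apply: is_derive_eq h _; rewrite addr0 /GRing.scale/= mulr1.
have h := @is_derive1_comp R (flat P) (fun t => s * t + c) t _ _ (is_derive_flat P _) d1.
by apply: is_derive_eq h _; rewrite mulrC.
Qed.

Lemma flat_gen_differentiable f : flat_gen f -> forall x, differentiable f x.
Proof.
elim=> [P i s c|c|f1 f2 _ h1 _ h2|f1 f2 _ h1 _ h2] x.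
- apply: (@differentiable_comp _ _ _ _ (fun y : V => y 0 i) (fun t => flat P (s * t + c))).
    exact: differentiable_coord.
  by apply/derivable1_diffP; have [] := is_derive_flat_affine P s c (x 0 i).
- exact: differentiable_cst.
- exact: (@differentiableD _ _ _ f1 f2).
- exact: (@differentiableM _ _ f1 f2).
Qed.

Lemma partial_coord (F : R -> R) (i j : 'I_N) (x : V) d : is_derive (x 0 i) 1 F d ->
  partial j (fun y => F (y 0 i)) x = (i == j)%:R * d.
Proof.
move=> [dF <-]; rewrite /partial /derive.
have [<-|ij] := eqVneq i j.
  rewrite mul1r.
  have -> // : (fun h : R => h^-1 *: (((fun y : V => F (y 0 i)) \o shift x)
      (h *: evec R i) - F (x 0 i))) =
    (fun h : R => h^-1 *: ((F \o shift (x 0 i)) (h *: 1) - F (x 0 i))).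
  by apply/funext => h /=; rewrite !mxE !eqxx.
rewrite mul0r.
have -> : (fun h : R => h^-1 *: (((fun y : V => F (y 0 i)) \o shift x)
    (h *: evec R j) - F (x 0 i))) = cst 0.
  by apply/funext => h /=; rewrite !mxE !eqxx (negbTE ij) mulr0 add0r subrr scaler0.
exact: lim_cst.
Qed.

Lemma flat_gen_partial f j : flat_gen f -> flat_gen (partial j f).
Proof.
have dv g : flat_gen g -> forall x, derivable g x (evec R j).
  by move=> hg x; apply: diff_derivable; exact: flat_gen_differentiable.
elim=> [P i s c|c|f1 f2 g1 h1 g2 h2|f1 f2 g1 h1 g2 h2].
- rewrite (_ : partial j _ = fun x => ((i == j)%:R * s) *
    flat ('X ^+ 2 * (P - P^`())) (s * x 0 i + c)).
    by apply: flat_genM; [exact: flat_gen_cst|exact: flat_gen_flat].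
  apply/funext => x.
  by rewrite (partial_coord j (is_derive_flat_affine P s c (x 0 i))) mulrA.
- rewrite (_ : partial j _ = fun=> 0); first exact: flat_gen_cst.
  by apply/funext => x; exact: derive_cst.
- rewrite (_ : partial j _ = fun x => partial j f1 x + partial j f2 x).
    exact: flat_genD.
  by apply/funext => x; exact: deriveD (dv _ g1 x) (dv _ g2 x).
- rewrite (_ : partial j _ = fun x => f1 x * partial j f2 x + f2 x * partial j f1 x).
    by apply: flat_genD; exact: flat_genM.
  by apply/funext => x; exact: deriveM (dv _ g1 x) (dv _ g2 x).
Qed.

Lemma flat_gen_smooth f : flat_gen f -> smooth f.
Proof.
move=> gf l; apply: flat_gen_differentiable.
by elim: l => [//|i l IH] /=; exact: flat_gen_partial.
Qed.

Definition bump1 (d t : R) : R := flat 1 t * flat 1 (d - t).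

Definition bump (a : V) (d : R) (x : V) : R := \prod_i bump1 d (x 0 i - a 0 i).

Lemma flat1_ge0 t : 0 <= flat 1 t :> R.
Proof. by rewrite /flat; case: ifP => // _; rewrite hornerC mul1r expR_ge0. Qed.

Lemma bump1_ge0 d t : 0 <= bump1 d t.
Proof. by rewrite mulr_ge0 ?flat1_ge0. Qed.

Lemma bump1_eq0 d t : (t <= 0) || (d <= t) -> bump1 d t = 0.
Proof.
rewrite /bump1 /flat => /orP[h|h]; first by rewrite ifN ?mul0r// -leNgt.
by rewrite [X in _ * X]ifN ?mulr0// -leNgt subr_le0.
Qed.

Lemma bump1_lb d t : 0 < d -> d / 4 <= t <= 3 * d / 4 ->
  expR (- (4 / d)) ^+ 2 <= bump1 d t.
Proof.
move=> d0 /andP[h1 h2].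
have lb s : d / 4 <= s -> expR (- (4 / d)) <= flat 1 s.
  move=> hs; have s0 : 0 < s by lra.
  rewrite /flat s0 hornerC mul1r ler_expR lerN2 -[leRHS]invf_div lef_pV2 ?posrE//.
  by rewrite divr_gt0.
by rewrite expr2 ler_pM ?expR_ge0 ?lb//; lra.
Qed.

Lemma bump_ge0 a d x : 0 <= bump a d x.
Proof. by apply: prodr_ge0 => i _; exact: bump1_ge0. Qed.

Lemma bump_testfun (Om : set V) (a : V) d : 0 < d ->
  (forall x : V, (forall i, a 0 i <= x 0 i <= a 0 i + d) -> Om x) ->
  testfun Om (bump a d).
Proof.
move=> d0 hO; split.
  apply: flat_gen_smooth; rewrite /bump.
  rewrite (_ : (fun x => _) = fun x : V => \prod_(i <- index_enum 'I_N)
    (flat 1 (1 * x 0 i + - a 0 i) * flat 1 (-1 * x 0 i + (d + a 0 i)))).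
    elim: (index_enum _) => [|i r IH].
      under eq_fun do rewrite big_nil; exact: flat_gen_cst.
    under eq_fun do rewrite big_cons.
    by apply: flat_genM => //; apply: flat_genM; exact: flat_gen_flat.
  apply/funext => x; apply: eq_bigr => i _; rewrite /bump1 mul1r; congr (_ * flat _ _); ring.
exists [set x : V | forall i, `[a 0 i, a 0 i + d]%classic (x 0 i)]; split.
- by apply: (rV_compact (A := fun i => `[a 0 i, a 0 i + d]%classic)) => i; exact: segment_compact.
- by move=> x /= h; apply: hO => i; have := h i; rewrite /= in_itv.
- move=> x /existsNP[i hi]; rewrite /bump (bigD1 i)//= bump1_eq0 ?mul0r//.
  rewrite leNgt leNgt -negb_and; apply/negP => /andP[h1 h2]; apply: hi.
  by rewrite /= in_itv/=; lra.
Qed.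

(** On the concentric cube of half the side [bump1_lb] gives a positive constant as lower bound, and
    that cube has positive volume. *)
Lemma bump_powR_gt0 (a : V) d c : 0 < d -> 0 < c ->
  (0 < iint (fun x => `|bump a d x| `^ c)%R)%E.
Proof.
move=> d0 c0.
have tb : testfun setT (bump a d) by exact: bump_testfun.
set k := ((expR (- (4 / d)) ^+ 2) ^+ N) `^ c.
have k0 : 0 < k by rewrite powR_gt0 ?exprn_gt0 ?expR_gt0.
pose J (i : 'I_N) : set R := `[a 0 i + d / 4, a 0 i + 3 * d / 4]%classic.
pose b i (t : R) : R := \1_(J i) t.
have bI i : (\int[@lebesgue_measure R]_t (b i t)%:E)%E = (d / 2)%:E.
  rewrite /b /J integral_indic// setIT.
  have := lebesgue_measure_itv (R := R) `[a 0 i + d / 4, a 0 i + 3 * d / 4].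
  rewrite /= => ->; rewrite lte_fin ifT; last by lra.
  by rewrite -EFinD; congr (_%:E); field.
have mb i : measurable_fun setT (b i).
  by apply: measurable_indic; exact: measurable_itv.
have b0 i t : 0 <= b i t by [].
have mprod : bmeas (fun x : V => \prod_i b i (x 0 i)).
  move=> d' T h mh; apply: measurable_prod => i _.
  by apply: measurableT_comp => //; exact: mh.
apply: (@lt_le_trans _ _ (iint (fun x : V => k * \prod_i b i (x 0 i)))).
  rewrite iintZ//; last 2 first.
  - exact: ltW.
  - by move=> x; exact: prodr_ge0.
  rewrite iint_prod//; last by move=> i; rewrite bI ltry.
  rewrite -EFinM lte_fin mulr_gt0// prodr_gt0// => i _.
  by rewrite bI/= divr_gt0.
apply: le_iint.
- by apply: bmeasM => //; exact: bmeas_cst.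
- by apply: bmeas_powR; apply: bmeas_norm; exact: testfun_bmeas tb.
- by move=> x; rewrite mulr_ge0 ?(ltW k0)// prodr_ge0.
move=> x; have [/forallP h|] := boolP [forall i, x 0 i \in J i].
  rewrite big1 ?mulr1; last by move=> i _; rewrite /b indicE h.
  apply: ge0_ler_powR; rewrite ?nnegrE ?(ltW c0) ?exprn_ge0 ?expR_ge0//.
  rewrite ger0_norm ?bump_ge0// -[X in _ ^+ X]card_ord -prodr_const.
  apply: ler_prod => i _; rewrite exprn_ge0 ?expR_ge0//=; apply: bump1_lb => //.
  by have := h i; rewrite /J inE/= in_itv/= => hi; lra.
rewrite negb_forall => /existsP[i hi].
by rewrite (bigD1 i)//= /b indicE (negbTE hi) mul0r mulr0 powR_ge0.
Qed.

End Bump.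

Lemma ge0_fin_ex (R : realType) (y : \bar R) : (0 <= y)%E -> (y < +oo)%E ->
  exists2 r, 0 <= r & y = r%:E.
Proof. by case: y => [r|//|//]; rewrite lee_fin => h _; exists r. Qed.

(** * Multiplication by constants and normalized bumps *)

Section Scaling.
Variables (R : realType) (N : nat).
Local Notation V := 'rV[R]_N.
Implicit Types (Om : set V) (u : V -> R) (g : 'I_N -> V -> R).

Lemma borel_funZ (c : R) u : borel_fun u -> borel_fun (fun x => c * u x).
Proof.
move=> bu B mB.
have mc : measurable_fun setT (fun y : R => c * y) by exact: measurable_funM.
have := mc measurableT B mB; rewrite setTI => h.
exact: (bu _ h).
Qed.

Lemma partialZ (c : R) f i : (forall x : V, differentiable f x) ->
  partial i (fun x => c * f x) = fun x => c * partial i f x.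
Proof.
by move=> df; apply/funext => x; apply: deriveZ; exact: diff_derivable.
Qed.

Lemma smoothZ (c : R) (f : V -> R) : smooth f -> smooth (fun x => c * f x).
Proof.
move=> sf l x.
have -> : Dl l (fun x => c * f x) = fun x => c * Dl l f x.
  elim: l {x} => [//|i l IH] /=.
  by rewrite IH partialZ// => y; exact: sf l y.
by apply: (@differentiableZ _ _ _ (Dl l f)); exact: sf.
Qed.

Lemma testfunZ (c : R) Om f : testfun Om f -> testfun Om (fun x => c * f x).
Proof.
move=> [sf [K [cK KO z]]]; split; first exact: smoothZ.
by exists K; split=> // x /z ->; rewrite mulr0.
Qed.

Lemma gradsqZ (c : R) g x : gradsq (fun i y => c * g i y) x = c ^+ 2 * gradsq g x.
Proof. by rewrite /gradsq mulr_sumr; apply: eq_bigr => i _; rewrite exprMn. Qed.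

Lemma H10Z (c : R) Om u g : H10 Om u g ->
  H10 Om (fun x => c * u x) (fun i x => c * g i x).
Proof.
move=> [bu [bg [phi [t cu cg]]]]; split; first exact: borel_funZ.
split; first by move=> i; exact: borel_funZ.
exists (fun k x => c * phi k x); split; first by move=> k; exact: testfunZ.
- rewrite (_ : (fun k => _) = (fun k => (c ^+ 2)%:E * iint (fun x => (phi k x - u x) ^+ 2)%R)%E).
    rewrite -[0%E](mule0 (c ^+ 2)%:E); exact: cvgeZl.
  apply/funext => k; rewrite -iintZ ?sqr_ge0//.
  + by congr iint; apply/funext => x; rewrite -mulrBr exprMn.
  + by apply: bmeasX; apply: bmeasB; [exact: testfun_bmeas (t k)|exact: borel_fun_bmeas].
  + by move=> x; exact: sqr_ge0.
- rewrite (_ : (fun k => _) = (fun k => (c ^+ 2)%:E *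
      iint (gradsq (fun i x => partial i (phi k) x - g i x)%R))%E).
    rewrite -[0%E](mule0 (c ^+ 2)%:E); exact: cvgeZl.
  apply/funext => k; rewrite -iintZ ?sqr_ge0//.
  + congr iint; apply/funext => x; rewrite -gradsqZ.
    apply: eq_bigr => i _; rewrite mulrBr partialZ//.
    by have [sm _] := t k; exact: (sm [::]).
  + apply: bmeas_gradsq => i; apply: bmeasB; last exact: borel_fun_bmeas.
    exact: testfun_partial_bmeas (t k).
  + by move=> x; exact: gradsq_ge0.
Qed.

Lemma intOZ (c : R) Om (f : V -> R) : open Om -> 0 <= c -> bmeas f -> (forall x, 0 <= f x) ->
  intO Om (fun x => c * f x) = (c%:E * intO Om f)%E.
Proof.
move=> oO c0 mf f0; rewrite /intO -iintZ//.
- by congr iint; apply/funext => x; rewrite mulrCA.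
- by apply: bmeasM => //; exact: bmeas_indic.
- by move=> x; rewrite mulr_ge0.
Qed.

Lemma intO_ge0 Om (f : V -> R) : (forall x, 0 <= f x) -> (0 <= intO Om f)%E.
Proof. by move=> f0; apply: iint_ge0 => x; rewrite mulr_ge0. Qed.

Lemma L2sqZ (c : R) Om u : open Om -> bmeas u ->
  L2sq Om (fun x => c * u x) = ((c ^+ 2)%:E * L2sq Om u)%E.
Proof.
move=> oO mu_; rewrite /L2sq -intOZ ?sqr_ge0//; last 2 first.
- exact: bmeasX.
- by move=> x; exact: sqr_ge0.
by congr intO; apply/funext => x; rewrite exprMn.
Qed.

Lemma DsqZ (c : R) Om g : open Om -> (forall i, bmeas (g i)) ->
  Dsq Om (fun i x => c * g i x) = ((c ^+ 2)%:E * Dsq Om g)%E.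
Proof.
move=> oO mg; rewrite /Dsq -intOZ ?sqr_ge0//; last 2 first.
- exact: bmeas_gradsq.
- by move=> x; exact: gradsq_ge0.
by congr intO; apply/funext => x; rewrite gradsqZ.
Qed.

Lemma testfun_H10 Om phi : testfun Om phi -> H10 Om phi (gradphi phi).
Proof.
move=> t; split; first by apply: continuous_borel_fun; exact: testfun_continuous t.
split.
  by move=> i; apply: continuous_borel_fun; exact: testfun_partial_continuous t.
exists (fun=> phi); split=> //.
- rewrite (_ : (fun k => _) = cst 0%E); first exact: cvg_cst.
  apply/funext => k; rewrite -[RHS](@iint0 R N); congr iint.
  by apply/funext => x; rewrite subrr expr0n.
- rewrite (_ : (fun k => _) = cst 0%E); first exact: cvg_cst.
  apply/funext => k; rewrite -[RHS](@iint0 R N); congr iint.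
  by apply/funext => x; apply: big1 => i _; rewrite subrr expr0n.
Qed.

Lemma intO_outside Om (f : V -> R) : (forall x, ~ Om x -> f x = 0) -> intO Om f = iint f.
Proof.
move=> z; congr iint; apply/funext => x; rewrite indicE.
have [xO|xO] := boolP (x \in Om); first by rewrite mul1r.
by rewrite mul0r z// => /mem_set; exact/negP.
Qed.

(** The last clause remembers where the bump vanishes, for the disjointness of two supports. *)
Lemma normalized_bump Om (a : V) (d : R) : open Om -> 0 < d ->
  (forall x : V, (forall i, a 0 i <= x 0 i <= a 0 i + d) -> Om x) ->
  exists phi, [/\ testfun Om phi, L2sq Om phi = 1%E, (Dsq Om (gradphi phi) < +oo)%E &
    forall x, bump a d x = 0 -> phi x = 0].
Proof.
move=> oO d0 hO; have t := bump_testfun d0 hO.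
have L2E : L2sq Om (bump a d) = iint (fun x => `|bump a d x| `^ 2).
  rewrite /L2sq intO_outside; last first.
    by move=> x /(testfun_outside t)[-> _]; rewrite expr0n.
  congr iint; apply/funext => x.
  by rewrite -[2]/(2%:R) powR_mulrn// real_normK ?num_real.
have L0 : (0 < L2sq Om (bump a d))%E by rewrite L2E bump_powR_gt0.
have Lf : (L2sq Om (bump a d) < +oo)%E by rewrite L2E; apply: testfun_powR_fin t.
have m0 : 0 < fine (L2sq Om (bump a d)) by rewrite fine_gt0// L0.
pose c := (Num.sqrt (fine (L2sq Om (bump a d))))^-1.
have tc := testfunZ c t.
exists (fun x => c * bump a d x); split => //.
- rewrite L2sqZ//; last exact: testfun_bmeas t.
  rewrite /c exprVn sqr_sqrtr ?(ltW m0)// -[X in (_ * X)%E]fineK; last first.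
    by rewrite ge0_fin_numE// ltW.
  by rewrite -EFinM mulVf// gt_eqF.
- rewrite /Dsq intO_outside; first exact: testfun_gradsq_fin tc.
  by move=> x /(testfun_outside tc)[_ h]; apply: big1 => i _; rewrite /gradphi h expr0n.
- by move=> x ->; rewrite mulr0.
Qed.

End Scaling.

(** * Two bumps with product zero *)

Section DisjointBumps.
Variables (R : realType) (n : nat).
Local Notation V := 'rV[R]_n.+1.

Lemma disjoint_bumps (Om : set V) : open Om -> Om !=set0 ->
  exists phi1 phi2 (K : R), [/\ [/\ testfun Om phi1, L2sq Om phi1 = 1%E & (Dsq Om (gradphi phi1) <= K%:E)%E],
    [/\ testfun Om phi2, L2sq Om phi2 = 1%E & (Dsq Om (gradphi phi2) <= K%:E)%E],
    0 <= K & forall x, phi1 x = 0 \/ phi2 x = 0].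
Proof.
move=> oO [x0 Ox0].
have /nbhs_ballP[e /= e0 eU] := open_nbhs_nbhs (conj oO Ox0).
pose d := e / 2; have d0 : 0 < d by rewrite divr_gt0.
have hb (x : V) : (forall i, `|x0 0 i - x 0 i| <= d) -> Om x.
  move=> h; apply: eU; split=> // i j; rewrite !ord1.
  rewrite /ball/=; apply: le_lt_trans (h j) _; rewrite /d; lra.
(* The second cube ends at the corner [x0] where the first one begins, so comparing first
   coordinates with that of [x0] tells which bump vanishes. *)
pose a2 : V := \row_i (x0 0 i - d).
have h1 (x : V) : (forall i, x0 0 i <= x 0 i <= x0 0 i + d) -> Om x.
  by move=> h; apply: hb => i; have := h i; rewrite ler_norml; lra.
have h2 (x : V) : (forall i, a2 0 i <= x 0 i <= a2 0 i + d) -> Om x.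
  by move=> h; apply: hb => i; have := h i; rewrite mxE ler_norml; lra.
have [phi1 [t1 L1 D1 z1]] := normalized_bump oO d0 h1.
have [phi2 [t2 L2 D2 z2]] := normalized_bump oO d0 h2.
have Dg0 phi : (0 <= Dsq Om (gradphi phi))%E.
  by apply: intO_ge0 => x; exact: gradsq_ge0.
have [K1 f1 F1] := ge0_fin_ex (Dg0 phi1) D1.
have [K2 f2 F2] := ge0_fin_ex (Dg0 phi2) D2.
exists phi1, phi2, (K1 + K2); split; last first.
- move=> x; have [h|h] := lerP (x 0 ord0) (x0 0 ord0).
    left; apply: z1; rewrite /bump (bigD1 ord0)//= bump1_eq0 ?mul0r//.
    by rewrite subr_le0 h.
  right; apply: z2; rewrite /bump (bigD1 ord0)//= bump1_eq0 ?mul0r//.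
  by apply/orP; right; rewrite mxE; lra.
- exact: addr_ge0.
- by split; [exact: t2|exact: L2|rewrite F2 lee_fin lerDr].
- by split; [exact: t1|exact: L1|rewrite F1 lee_fin lerDl].
Qed.

End DisjointBumps.

(** * Cauchy-Schwarz with bounds that may be zero *)

Section CauchySchwarz.
Variable R : realType.

(** The bound 0 is replaced by [e ^ 2 / (B + 1)], which makes the product of the square roots equal
    to an arbitrary [e]. *)
Lemma iint_cauchy0 k (f g : 'rV[R]_k -> R) (B : R) : bmeas f -> bmeas g ->
  (forall x, 0 <= f x) -> (forall x, 0 <= g x) -> 0 <= B ->
  (iint f <= 0)%E -> (iint g <= B%:E)%E ->
  (iint (fun x => f x `^ 2^-1 * g x `^ 2^-1)%R <= 0)%E.
Proof.
move=> mf mg f0 g0 B0 hf hg; apply/lee_addgt0Pr => e e0; rewrite add0e.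
have B10 : 0 < B + 1 by rewrite ltr_wpDl.
have ep : 0 < e ^+ 2 / (B + 1) by rewrite divr_gt0// exprn_gt0.
have := iint_hoelder (th := 2^-1) mf mg f0 g0 _ ep B10 _ _.
rewrite (_ : 1 - 2^-1 = 2^-1 :> R); last by field.
move=> h; apply: le_trans (h _ _ _) _; first by lra.
- by apply: le_trans hf _; rewrite lee_fin ltW.
- by apply: le_trans hg _; rewrite lee_fin lerDl.
rewrite lee_fin -powRM ?(ltW ep) ?(ltW B10)// mulfVK ?gt_eqF//.
by rewrite -powR_mulrn ?(ltW e0)// -powRrM divff// powRr1// ltW.
Qed.

Lemma iint_cauchy k (f g : 'rV[R]_k -> R) (A B : R) : bmeas f -> bmeas g ->
  (forall x, 0 <= f x) -> (forall x, 0 <= g x) -> 0 <= A -> 0 <= B ->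
  (iint f <= A%:E)%E -> (iint g <= B%:E)%E ->
  (iint (fun x => f x `^ 2^-1 * g x `^ 2^-1)%R <= (A `^ 2^-1 * B `^ 2^-1)%:E)%E.
Proof.
move=> mf mg f0 g0 A0 B0 hf hg.
have h0 : (0%E <= (A `^ 2^-1 * B `^ 2^-1)%:E)%E by rewrite lee_fin mulr_ge0 ?powR_ge0.
move: (A0); rewrite le_eqVlt => /predU1P[AE|A1].
  by apply: le_trans h0; apply: iint_cauchy0 B0 _ hg => //; rewrite -AE in hf.
move: (B0); rewrite le_eqVlt => /predU1P[BE|B1].
  apply: le_trans h0; under eq_fun do rewrite mulrC.
  by apply: iint_cauchy0 A0 _ hf => //; rewrite -BE in hg.
have := iint_hoelder (th := 2^-1) mf mg f0 g0 _ A1 B1 hf hg.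
by rewrite (_ : 1 - 2^-1 = 2^-1 :> R); [apply; lra|field].
Qed.

End CauchySchwarz.

(** * The energy under scaling, and star-shapedness *)

Section Energy.
Variables (R : realType) (n : nat) (Om : set 'rV[R]_n.+1) (p C a s : R).
Hypothesis oO : open Om.
Hypothesis p1 : 1 < p.
Hypothesis C0 : 0 < C.
Hypothesis gn : forall (u : 'rV[R]_n.+1 -> R) g (rho G : R),
  H10 Om u g -> 0 <= rho -> 0 < G ->
  (L2sq Om u <= rho%:E)%E -> (Dsq Om g <= G%:E)%E ->
  (intO Om (fun x => `|u x| `^ (p + 1))%R <= (C * G `^ a * rho `^ s)%:E)%E.

Local Notation pair := (pairH R n.+1).

Definition scalew (c : R) (w : pair) : pair :=
  let: (u1, g1, u2, g2) := w in
  (fun x => c * u1 x, fun i x => c * g1 i x, fun x => c * u2 x, fun i x => c * g2 i x).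

Lemma scalewK c w : c != 0 -> scalew c (scalew c^-1 w) = w.
Proof.
case: w => [[[u1 g1] u2] g2] c0 /=; congr (_, _, _, _).
- by apply/funext => x; rewrite mulVKf.
- by apply/funext => i; apply/funext => x; rewrite mulVKf.
- by apply/funext => x; rewrite mulVKf.
- by apply/funext => i; apply/funext => x; rewrite mulVKf.
Qed.

Lemma scalew1 w : scalew 1 w = w.
Proof.
case: w => [[[u1 g1] u2] g2] /=; congr (_, _, _, _).
- by apply/funext => x; rewrite mul1r.
- by apply/funext => i; apply/funext => x; rewrite mul1r.
- by apply/funext => x; rewrite mul1r.
- by apply/funext => i; apply/funext => x; rewrite mul1r.
Qed.

Lemma powR_intOZ (c q : R) (u : 'rV[R]_n.+1 -> R) : 0 <= c -> bmeas u ->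
  intO Om (fun x => `|c * u x| `^ q) = ((c `^ q)%:E * intO Om (fun x => `|u x| `^ q)%R)%E.
Proof.
move=> c0 mu_; rewrite -intOZ ?powR_ge0//; last by apply: bmeas_powR; exact: bmeas_norm.
by congr intO; apply/funext => x; rewrite normrM (ger0_norm c0) powRM.
Qed.

(* [D], [I1], [I12], [I2] are the (finite) values of the integrals in the energy. *)
Lemma energy_data (rho1 rho2 A : R) (w : pair) : 0 <= rho1 -> 0 <= rho2 ->
  Mset Om rho1 rho2 w -> (gradsum Om w <= A%:E)%E ->
  exists D I1 I12 I2 : R, [/\ 0 <= D, 0 <= I1, 0 <= I12, 0 <= I2 &
    gradsum Om w = D%:E /\
    (forall mu1 mu2 beta c, 0 <= c ->
      [/\ Mset Om (c ^+ 2 * rho1) (c ^+ 2 * rho2) (scalew c w),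
       gradsum Om (scalew c w) = (c ^+ 2 * D)%:E &
       energy Om p mu1 mu2 beta (scalew c w) =
        (2^-1 * (c ^+ 2 * D) - (p + 1)^-1 * (c `^ (p + 1)
           * (mu1 * I1 + 2 * beta * I12 + mu2 * I2)))%:E]) /\
    (forall G, 0 < G -> D <= G -> [/\ I1 <= C * G `^ a * rho1 `^ s,
       I2 <= C * G `^ a * rho2 `^ s &
       I12 <= C * G `^ a * (rho1 `^ (s / 2) * rho2 `^ (s / 2))])].
Proof.
case: w => [[[u1 g1] u2] g2] r1 r2 [H1 H2 L1 L2] hA.
have mu1 : bmeas u1 by case: H1 => /borel_fun_bmeas.
have mu2 : bmeas u2 by case: H2 => /borel_fun_bmeas.
have mg1 i : bmeas (g1 i) by case: H1 => _ [h _]; exact: borel_fun_bmeas.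
have mg2 i : bmeas (g2 i) by case: H2 => _ [h _]; exact: borel_fun_bmeas.
have Dg0 g : (0 <= Dsq Om g)%E by apply: intO_ge0 => x; exact: gradsq_ge0.
have p1' := p1.
have p0 : p + 1 != 0 by rewrite gt_eqF//; lra.
have fin_ex (y : \bar R) (b : R) : (0 <= y)%E -> (y <= b%:E)%E -> exists2 r, 0 <= r & y = r%:E.
  by case: y => [r|//|//]; rewrite lee_fin => h _; exists r.
have [D1 D10 D1E] : exists2 r, 0 <= r & Dsq Om g1 = r%:E.
  by apply: (fin_ex _ A) => //; apply: le_trans hA; rewrite leeDl.
have [D2 D20 D2E] : exists2 r, 0 <= r & Dsq Om g2 = r%:E.
  by apply: (fin_ex _ A) => //; apply: le_trans hA; rewrite leeDr.
have b1 G : 0 < G -> D1 <= G ->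
    (intO Om (fun x => `|u1 x| `^ (p + 1))%R <= (C * G `^ a * rho1 `^ s)%:E)%E.
  by move=> G0 hG; apply: gn H1 _ G0 _ _ => //; rewrite ?L1// D1E lee_fin.
have b2 G : 0 < G -> D2 <= G ->
    (intO Om (fun x => `|u2 x| `^ (p + 1))%R <= (C * G `^ a * rho2 `^ s)%:E)%E.
  by move=> G0 hG; apply: gn H2 _ G0 _ _ => //; rewrite ?L2// D2E lee_fin.
have b12 G : 0 < G -> D1 <= G -> D2 <= G ->
    (intO Om (fun x => `|u1 x| `^ ((p + 1) / 2) * `|u2 x| `^ ((p + 1) / 2))%R <=
      (C * G `^ a * (rho1 `^ (s / 2) * rho2 `^ (s / 2)))%:E)%E.
  move=> G0 h1 h2.
  have mi := bmeas_indic (R := R) oO.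
  have mP u : bmeas u -> bmeas (fun x => \1_Om x * `|u x| `^ (p + 1)).
    by move=> mu_; apply: bmeasM => //; apply: bmeas_powR; exact: bmeas_norm.
  have P0 (u : 'rV[R]_n.+1 -> R) x : 0 <= \1_Om x * `|u x| `^ (p + 1) :> R by rewrite mulr_ge0 ?powR_ge0.
  have CG0 rho : 0 <= C * G `^ a * rho `^ s by rewrite !mulr_ge0 ?powR_ge0 ?(ltW C0).
  have := iint_cauchy (mP _ mu1) (mP _ mu2) (P0 u1) (P0 u2) (CG0 rho1) (CG0 rho2)
    (b1 _ G0 h1) (b2 _ G0 h2).
  have -> : (C * G `^ a * rho1 `^ s) `^ 2^-1 * (C * G `^ a * rho2 `^ s) `^ 2^-1 =
      C * G `^ a * (rho1 `^ (s / 2) * rho2 `^ (s / 2)).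
    have CG : 0 <= C * G `^ a by rewrite mulr_ge0 ?powR_ge0 ?(ltW C0).
    have hh : 2^-1 + 2^-1 = 1 :> R by field.
    rewrite !(powRM _ CG) ?powR_ge0// -!powRrM mulrACA -powRD hh ?oner_eq0//.
    by rewrite powRr1.
  apply: le_trans; rewrite /intO le_eqVlt; apply/orP; left; apply/eqP; congr iint.
  apply/funext => x; rewrite indicE; case: (_ \in _).
    by rewrite !mul1r -!powRrM.
  by rewrite !mul0r powR0 ?mul0r// invr_neq0.
have pI0 (u : 'rV[R]_n.+1 -> R) : (0 <= intO Om (fun x => `|u x| `^ (p + 1))%R)%E.
  by apply: intO_ge0 => x; exact: powR_ge0.
(* The added 1 keeps the bound positive, as [gn] requires, when both gradients vanish. *)
pose G1 := D1 + D2 + 1.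
have G10 : 0 < G1 by rewrite /G1; lra.
have DG1 : D1 <= G1 by rewrite /G1; lra.
have DG2 : D2 <= G1 by rewrite /G1; lra.
have [I1 I10 I1E] := fin_ex _ _ (pI0 u1) (b1 _ G10 DG1).
have [I2 I20 I2E] := fin_ex _ _ (pI0 u2) (b2 _ G10 DG2).
have [I12 I120 I12E] := fin_ex _ _
  (intO_ge0 Om (fun x => mulr_ge0 (powR_ge0 _ _) (powR_ge0 _ _))) (b12 _ G10 DG1 DG2).
exists (D1 + D2), I1, I12, I2; split=> //; first exact: addr_ge0.
split; first by rewrite /= D1E D2E -EFinD.
split; last first.
  move=> G G0 hG; have h1 : D1 <= G by lra. have h2 : D2 <= G by lra.
  by split; rewrite -lee_fin -?I1E -?I2E -?I12E; [exact: b1|exact: b2|exact: b12].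
move=> m1 m2 beta c c0.
have gE : gradsum Om (scalew c (u1, g1, u2, g2)) = (c ^+ 2 * (D1 + D2))%:E.
  by rewrite /= !DsqZ// D1E D2E -!EFinM -EFinD mulrDr.
split=> //.
  by split; rewrite ?L2sqZ ?L1 ?L2 ?EFinM//; exact: H10Z.
have cc : c `^ (p + 1) = c `^ ((p + 1) / 2) * c `^ ((p + 1) / 2).
  rewrite -powRD; last by rewrite -splitr (negbTE p0).
  by rewrite -splitr.
have I12Z : intO Om (fun x => `|c * u1 x| `^ ((p + 1) / 2) * `|c * u2 x| `^ ((p + 1) / 2)) =
    ((c `^ (p + 1))%:E * I12%:E)%E.
  have mI : bmeas (fun x => `|u1 x| `^ ((p + 1) / 2) * `|u2 x| `^ ((p + 1) / 2)).
    by apply: bmeasM; apply: bmeas_powR; exact: bmeas_norm.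
  rewrite -I12E -(intOZ oO (powR_ge0 c (p + 1)) mI); last first.
    by move=> x; rewrite mulr_ge0 ?powR_ge0.
  congr intO; apply/funext => x.
  by rewrite !normrM (ger0_norm c0) !powRM// cc mulrACA.
have I1Z := powR_intOZ (p + 1) c0 mu1.
have I2Z := powR_intOZ (p + 1) c0 mu2.
move: gE; rewrite /energy /= I1Z I2Z I12Z I1E I2E => ->.
by rewrite -?(EFinM, EFinD, EFinN); congr (_%:E); ring.
Qed.

Lemma energy_testfun (mu1 mu2 beta rho1 rho2 K : R) phi1 phi2 :
  0 <= mu1 -> 0 <= mu2 -> 0 <= rho1 -> 0 <= rho2 -> 0 <= K ->
  [/\ testfun Om phi1, L2sq Om phi1 = 1%E & (Dsq Om (gradphi phi1) <= K%:E)%E] ->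
  [/\ testfun Om phi2, L2sq Om phi2 = 1%E & (Dsq Om (gradphi phi2) <= K%:E)%E] ->
  (forall x, phi1 x = 0 \/ phi2 x = 0) ->
  exists w : pair, [/\ Mset Om rho1 rho2 w,
    (gradsum Om w <= ((rho1 + rho2) * K)%:E)%E &
    (energy Om p mu1 mu2 beta w <= (2^-1 * ((rho1 + rho2) * K))%:E)%E].
Proof.
have p1' := p1.
move=> m1 m2 r1 r2 K0 [t1 L1 D1] [t2 L2 D2] dis.
pose c1 := Num.sqrt rho1; pose c2 := Num.sqrt rho2.
pose w : pair := (fun x => c1 * phi1 x, fun i x => c1 * gradphi phi1 i x,
  fun x => c2 * phi2 x, fun i x => c2 * gradphi phi2 i x).
have MW : Mset Om rho1 rho2 w.
  split; [exact/H10Z/testfun_H10|exact/H10Z/testfun_H10| |].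
    by rewrite L2sqZ ?L1 ?sqr_sqrtr ?mule1//; exact: testfun_bmeas t1.
  by rewrite L2sqZ ?L2 ?sqr_sqrtr ?mule1//; exact: testfun_bmeas t2.
have gw : (gradsum Om w <= ((rho1 + rho2) * K)%:E)%E.
  rewrite /= DsqZ//; last by move=> i; exact: testfun_partial_bmeas t1.
  rewrite DsqZ//; last by move=> i; exact: testfun_partial_bmeas t2.
  rewrite !sqr_sqrtr// mulrDl EFinD !EFinM.
  by apply: leeD; apply: lee_wpmul2l => //; rewrite lee_fin.
exists w; split=> //.
have [D [I1 [I12 [I2 [D0 I10 I120 I20 [DE [He _]]]]]]] := energy_data r1 r2 MW gw.
have DK : D <= (rho1 + rho2) * K by rewrite -lee_fin -DE.
have [_ _ E0] := He mu1 mu2 0 1 ler01.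
(* The coupling integral vanishes, so [beta] may be set to 0, after which the interaction can only
   lower the energy. *)
have EE : energy Om p mu1 mu2 beta w = energy Om p mu1 mu2 0 w.
  have z : intO Om (fun x => `|c1 * phi1 x| `^ ((p + 1) / 2) * `|c2 * phi2 x| `^ ((p + 1) / 2)) = 0%E.
    rewrite -[RHS](@iint0 R n.+1); congr iint; apply/funext => x.
    have p20 : (p + 1) / 2 != 0 by rewrite gt_eqF//; lra.
    by have [->|->] := dis x; rewrite mulr0 normr0 powR0// ?mul0r ?mulr0.
  by rewrite /energy /w z !mule0.
rewrite scalew1 in E0; rewrite EE E0 lee_fin expr1n powR1 !mul1r mulr0 mul0r addr0.
apply: (@le_trans _ _ (2^-1 * D)); last by rewrite ler_wpM2l.
by rewrite gerBl mulr_ge0 ?addr_ge0 ?mulr_ge0// invr_ge0; lra.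
Qed.

Lemma star_shaped_admissible (mu1 mu2 beta : R) :
  star_shaped0 (admissible Om p mu1 mu2 beta).
Proof.
have p1' := p1.
move=> [rho1 rho2] t /= [[/= r1 [r2 [al [l1 hc crit]]]]|[-> ->]] /andP[t0 t1]; last first.
  by right; rewrite !mulr0.
move: t0; rewrite le_eqVlt => /predU1P[<-|t0]; first by right; rewrite !mul0r.
left; split; first by rewrite mulr_ge0// ltW.
split; first by rewrite mulr_ge0// ltW.
exists al; split => //=; last first.
  move=> /crit; apply: le_trans; rewrite -mulrDr -mulrA ler_piMl//.
  by apply: mulr_ge0; [exact: addr_ge0|rewrite subr_ge0].
set rr := rho1 + rho2.
pose c := Num.sqrt t; have c0 : 0 < c by rewrite sqrtr_gt0.
have c2 : c ^+ 2 = t by rewrite sqr_sqrtr// ltW.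
have cn0 : c != 0 by rewrite gt_eqF.
(* Equal to [t ^ ((p + 1) / 2)], the factor by which the interaction terms scale, whereas the
   Dirichlet energy scales by [t]. *)
set k := c `^ (p + 1); have k0 : 0 < k by rewrite powR_gt0.
have kt : k <= t.
  rewrite -c2 -powR_mulrn ?(ltW c0)//; apply: ger_powR; last by lra.
  by rewrite c0 -sqrtr1 ler_wsqrtr.
have [_ [w [Mw gw] <-] ew] := ereal_inf_lt hc.
have [D [I1 [I12 [I2 [D0 _ _ _ [DE [He _]]]]]]] := energy_data r1 r2 Mw gw.
have DA : D <= rr * al by rewrite -lee_fin -DE.
have [_ _ E1] := He mu1 mu2 beta 1 ler01.
have [Mc gc Ec] := He mu1 mu2 beta c (ltW c0).
rewrite scalew1 expr1n powR1 !mul1r in E1.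
move: E1 Ec; set F := (mu1 * I1 + _ + _); set pi := (p + 1)^-1 => E1 Ec.
(* A real number strictly above one energy is needed: [chat_alpha] is infinite when [Uset] is empty,
   and the gap between the infima must remain strict. *)
have [z ez hz] : exists2 z, 2^-1 * D - pi * F < z &
    (z%:E <= chat_alpha Om p mu1 mu2 beta rho1 rho2 al)%E.
  move: ew; rewrite E1; case: (chat_alpha _ _ _ _ _ _ _ _) => [y| |] //.
    by rewrite lte_fin => h; exists y.
  by move=> _; exists (2^-1 * D - pi * F + 1); rewrite ?leey// ltrDl.
apply: (@le_lt_trans _ _ (energy Om p mu1 mu2 beta (scalew c w))).
  apply: ereal_inf_lbound; exists (scalew c w) => //; split; first by rewrite -c2.
  by rewrite gc lee_fin c2 -mulrDr -mulrA ler_wpM2l// ltW.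
rewrite Ec c2 -/k.
(* This number separates the infima for the scaled masses: it exceeds the energy of the scaled [w],
   where [D <= rr * al], and is at most every energy on [Uset], where the Dirichlet energy is
   exactly [t * (rr * al)]. *)
apply: (@lt_le_trans _ _ ((2^-1 * (t - k) * (rr * al) + k * z)%:E)).
  rewrite lte_fin.
  have h1 : k * (2^-1 * D - pi * F) < k * z by rewrite ltr_pM2l.
  have h2 : (t - k) * D <= (t - k) * (rr * al) by rewrite ler_wpM2l// subr_ge0.
  lra.
apply: le_ereal_inf_tmp => _ [v [Mv gv] <-].
have tr1 : 0 <= t * rho1 by rewrite mulr_ge0// ltW.
have tr2 : 0 <= t * rho2 by rewrite mulr_ge0// ltW.
have gv' : (gradsum Om v <= ((t * rho1 + t * rho2) * al)%:E)%E by rewrite gv.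
have [D' [J1 [J12 [J2 [_ _ _ _ [DE' [He' _]]]]]]] := energy_data tr1 tr2 Mv gv'.
have D'E : D' = t * (rr * al).
  by move: DE'; rewrite gv -mulrDr -mulrA => -[].
have [_ _ E1'] := He' mu1 mu2 beta 1 ler01.
have ci0 : 0 <= c^-1 by rewrite invr_ge0 ltW.
have [Mc' gc' Ec'] := He' mu1 mu2 beta c^-1 ci0.
rewrite scalew1 expr1n powR1 !mul1r in E1'.
move: E1' Ec'; set F' := (mu1 * J1 + _ + _) => E1' Ec'.
have cD : c^-1 ^+ 2 * D' = rr * al.
  by rewrite D'E exprVn c2 mulKf// gt_eqF.
have : (z%:E <= energy Om p mu1 mu2 beta (scalew c^-1 v))%E.
  apply: le_trans hz _; apply: ereal_inf_lbound; exists (scalew c^-1 v) => //.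
  split; last by rewrite gc' cD.
  by move: Mc'; rewrite exprVn c2 !mulKf// gt_eqF.
rewrite Ec' E1' !lee_fin cD -/pi.
have -> : c^-1 `^ (p + 1) = k^-1.
  have kV : c^-1 `^ (p + 1) * k = 1 by rewrite /k -powRM ?(ltW c0)// mulVf// powR1.
  by rewrite -[LHS](mulfK (lt0r_neq0 k0)) kV mul1r.
move=> h; have := ler_wpM2l (ltW k0) h.
rewrite mulrBr [k * (pi * _)]mulrCA [k * (_ * F')]mulrA divff ?gt_eqF// mul1r D'E.
lra.
Qed.

End Energy.

(** * Bounds on the first eigenvalue, the Sobolev constant and Lambda *)

Section Constants.
Variables (R : realType) (n : nat).
Local Notation V := 'rV[R]_n.+1.

(** The upper bound makes [K + 1] an allowed value of alpha; nonnegativity lets [al - lambda1 Om] be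
    replaced by [al] in the critical case. *)
Lemma lambda1_bounds (Om : set V) phi (K : R) : testfun Om phi ->
  L2sq Om phi = 1%E -> (Dsq Om (gradphi phi) <= K%:E)%E ->
  0 <= lambda1 Om <= K.
Proof.
move=> t L1 DK.
set E := [set r : R | exists (u : V -> R) (g : 'I_n.+1 -> V -> R),
        [/\ H10 Om u g, (0 < L2sq Om u < +oo)%E & r = fine (Dsq Om g) / fine (L2sq Om u)] ].
have D0 g : (0 <= Dsq Om g)%E by apply: intO_ge0 => x; exact: gradsq_ge0.
have lb : lbound E 0.
  move=> _ [u [g [_ /andP[h _] ->]]]; rewrite divr_ge0 ?fine_ge0//; exact: ltW.
have Ephi : E (fine (Dsq Om (gradphi phi))).
  exists phi, (gradphi phi); split; first exact: testfun_H10.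
    by rewrite L1 lte01 ltry.
  by rewrite L1 /= divr1.
apply/andP; split.
  by apply: lb_le_inf lb; exists (fine (Dsq Om (gradphi phi))).
apply: (@le_trans _ _ (fine (Dsq Om (gradphi phi)))).
  by apply: ge_inf Ephi; exists 0.
move: DK (D0 (gradphi phi)); case: (Dsq _ _) => [r|//|//].
by rewrite lee_fin.
Qed.

(** Testing with a single bump bounds all admissible constants below by the same positive number. *)
Lemma sobolev_const_gt0 : (2 < n.+1)%N -> 0 < @sobolev_const R n.+1.
Proof.
move=> N2; have [S S0 HS] := @sobolev_inequality R n N2.
have q2 := @crit_exp_gt2 R _ N2.
set q := @crit_exp R n.+1 in HS q2 *.
have q0 : 0 < q by lra.
pose phi : V -> R := bump 0 1.
have t : testfun setT phi by exact: bump_testfun.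
have Dphi : D12 q phi (gradphi phi).
  have [bu [bg _]] := testfun_H10 t.
  split=> //; split=> //; exists (fun=> phi); split=> //.
  - rewrite (_ : (fun k => _) = cst 0%E); first exact: cvg_cst.
    apply/funext => k; rewrite -[RHS](@iint0 R n.+1); congr iint.
    by apply/funext => x; rewrite subrr normr0 powR0// gt_eqF.
  - rewrite (_ : (fun k => _) = cst 0%E); first exact: cvg_cst.
    apply/funext => k; rewrite -[RHS](@iint0 R n.+1); congr iint.
    by apply/funext => x; apply: big1 => i _; rewrite subrr expr0n.
have I0 : (0 < iint (fun x => `|phi x| `^ q)%R)%E by exact: bump_powR_gt0.
have [c0 _ cE] := ge0_fin_ex (ltW I0) (testfun_powR_fin q0 t).
have c00 : 0 < c0 by move: I0; rewrite cE lte_fin.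
set X := (fine (iint (gradsq (gradphi phi)))) `^ (q / 2).
(* The Sobolev inequality itself excludes a bump of zero gradient energy. *)
have X0 : 0 < X.
  have [_] := HS _ _ Dphi; rewrite cE lee_fin -/X => h.
  rewrite lt0r powR_ge0 andbT; apply/eqP => XE.
  by move: h; rewrite XE mulr0 leNgt c00.
apply: (@lt_le_trans _ _ (c0 / X)); first by rewrite divr_gt0.
apply: lb_le_inf.
  by exists S => v g /HS[].
move=> S1 /(_ _ _ Dphi); rewrite cE lee_fin -/X => h.
by rewrite ler_pdivrMr.
Qed.

(** The point (1, 0) of the circle contributes the value [mu1], which makes the [sup] positive; all
    powers on the circle are at most 1, which bounds it by [mu1 + mu2 + 2 * b]. *)
Lemma Lambda_bounds (mu1 mu2 beta : R) : (2 < n.+1)%N -> 0 < mu1 -> 0 < mu2 ->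
  0 < @Lambda R n.+1 mu1 mu2 beta <=
  4 * @sobolev_const R n.+1 / @crit_exp R n.+1 * (Num.max mu1 mu2 + Num.max beta 0).
Proof.
move=> N2 m1 m2; set q := @crit_exp R n.+1; have S0 := sobolev_const_gt0 N2.
have q2 : 2 < q := @crit_exp_gt2 R _ N2.
have q0 : 0 < q by lra.
set b := Num.max beta 0; have b0 : 0 <= b by rewrite le_max lexx orbT.
have M1 : mu1 <= Num.max mu1 mu2 by rewrite le_max lexx.
have M2 : mu2 <= Num.max mu1 mu2 by rewrite le_max lexx orbT.
rewrite /Lambda -/q -/b; set E := [set m | _].
have Eub : ubound E (2 * (Num.max mu1 mu2 + b)).
  move=> _ [x [y [xy ->]]].
  have x2 : `|x| <= 1.
    rewrite -(@expr_le1 _ 2)// real_normK ?num_real//; have := sqr_ge0 y; lra.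
  have y2 : `|y| <= 1.
    rewrite -(@expr_le1 _ 2)// real_normK ?num_real//; have := sqr_ge0 x; lra.
  have pw (z s : R) : 0 <= s -> `|z| <= 1 -> `|z| `^ s <= 1.
    move=> s0 z1; have -> : 1 = 1 `^ s :> R by rewrite powR1.
    by apply: ge0_ler_powR; rewrite ?nnegrE.
  have h1 : mu1 * `|x| `^ q <= mu1 by rewrite ler_piMr ?(ltW m1)// pw// ltW.
  have h2 : mu2 * `|y| `^ q <= mu2 by rewrite ler_piMr ?(ltW m2)// pw// ltW.
  have h3 : 2 * b * `|x * y| `^ (q / 2) <= 2 * b.
    rewrite ler_piMr ?mulr_ge0// pw//; first by rewrite divr_ge0// ltW.
    by rewrite normrM mulr_ile1.
  lra.
have E1 : E mu1.
  exists 1, 0; split; first by rewrite expr1n expr0n/= addr0.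
  rewrite normr1 powR1 mulr1 normr0 mulr0 normr0 !powR0 ?mulr0 ?addr0// gt_eqF//.
  by rewrite divr_gt0.
have sE1 : mu1 <= sup E by apply: ub_le_sup E1; exists (2 * (Num.max mu1 mu2 + b)).
have sE2 : sup E <= 2 * (Num.max mu1 mu2 + b) by apply: ge_sup Eub; exists mu1.
have c0 : 0 < 2 * @sobolev_const R n.+1 / q by rewrite divr_gt0// mulr_gt0.
have sE0 : 0 < sup E := lt_le_trans m1 sE1.
apply/andP; split; first exact: mulr_gt0.
apply: le_trans (ler_wpM2l (ltW c0) sE2) _.
by rewrite le_eqVlt; apply/orP; left; apply/eqP; ring.
Qed.

(** The claim amounts to an upper bound for [Lambda] by the power [- 2 / (N - 2)] of [rho * al].
    Inserting the bound of [Lambda_bounds] and separating [rho] from [al] yields [R2]. *)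
Lemma critical_mass_bound (al : R) : (2 < n.+1)%N -> 0 < al ->
  exists2 R2 : R, 0 < R2 & forall mu1 mu2 beta rho : R, 0 < mu1 -> 0 < mu2 -> 0 < rho ->
    (Num.max mu1 mu2 + Num.max beta 0) * rho `^ (2 / (n.+1%:R - 2)) <= R2 ->
    rho * al <= @Lambda R n.+1 mu1 mu2 beta `^ (- ((n.+1%:R - 2) / 2)).
Proof.
move=> N2 al0.
have N2R : 0 < n.+1%:R - 2 :> R by rewrite subr_gt0 ltr_nat.
have S0 := sobolev_const_gt0 N2.
have q2 := @crit_exp_gt2 R _ N2.
set q := @crit_exp R n.+1 in q2.
pose e : R := (n.+1%:R - 2) / 2.
have e0 : 0 < e by rewrite divr_gt0.
have eV : 2 / (n.+1%:R - 2) = e^-1 :> R by rewrite invf_div.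
pose k := 4 * @sobolev_const R n.+1 / q.
have q0 : 0 < q by lra.
have k0 : 0 < k by apply: divr_gt0 q0; exact: mulr_gt0.
exists (k^-1 * al `^ (- e^-1)); first by rewrite mulr_gt0 ?invr_gt0 ?powR_gt0.
move=> mu1 mu2 beta rho m1 m2 rho0; rewrite eV -/e => h.
have /andP[L0] := Lambda_bounds beta N2 m1 m2; rewrite -/q -/k => Lk.
set T := Num.max mu1 mu2 + _ in h Lk.
set L := Lambda _ _ _ _ in L0 Lk *.
have x0 : 0 < rho * al by rewrite mulr_gt0.
have Lx : L <= (rho * al) `^ (- e^-1).
  apply: le_trans Lk _; rewrite powRM ?(ltW rho0) ?(ltW al0)// powRN.
  rewrite [leRHS]mulrC ler_pdivlMr ?powR_gt0// -mulrA.
  by rewrite -(ler_pM2l (_ : 0 < k^-1)) ?invr_gt0// mulKf ?gt_eqF.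
have : L `^ e <= ((rho * al) `^ (- e^-1)) `^ e.
  by apply: ge0_ler_powR => //; rewrite ?nnegrE ?powR_ge0 ?(ltW e0) ?(ltW L0).
rewrite -powRrM mulNr mulVf ?gt_eqF// powRN powRr1 ?(ltW x0)// => h2.
by rewrite powRN -[leLHS]invrK lef_pV2 ?posrE ?invr_gt0 ?powR_gt0.
Qed.

End Constants.

(** * Choice of alpha and of the smallness constant *)

Theorem theorem1p5 (R : realType) (n : nat) (Om : set 'rV[R]_n.+1) (p : R) :
  lipschitz_domain Om ->
  1 + 4 / n.+1%:R < p ->
  ((2 < n.+1)%N -> p <= @crit_exp R n.+1 - 1) ->
  let a := n.+1%:R * (p - 1) / 4 in
  let r := (p + 1) / 4 - n.+1%:R * (p - 1) / 8 in
  (forall mu1 mu2 beta : R, 0 < mu1 -> 0 < mu2 ->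
     star_shaped0 (admissible Om p mu1 mu2 beta)) /\
  exists Rc : R, 0 < Rc /\
    forall mu1 mu2 beta rho1 rho2 : R,
      0 < mu1 -> 0 < mu2 -> 0 <= rho1 -> 0 <= rho2 ->
      (Num.max (mu1 * rho1 `^ (2 * r)) (mu2 * rho2 `^ (2 * r))
         + Num.max beta 0 * rho1 `^ r * rho2 `^ r) * (rho1 + rho2) `^ (a - 1) <= Rc ->
      admissible Om p mu1 mu2 beta (rho1, rho2).
Proof.
move=> [oO O0 _ _ _] hp hcrit a r.
have p1 : 1 < p by apply: lt_trans hp; rewrite ltrDl divr_gt0 ?ltr0n.
have hq : 2 + 4 / n.+1%:R < p + 1.
  by move: hp; rewrite -(ltrD2r 1) addrAC -natr1.
have hqc : (2 < n.+1)%N -> p + 1 <= 2 * n.+1%:R / (n.+1%:R - 2).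
  by move=> /hcrit; rewrite lerBrDr.
have [C C0 HC] := gn_H10 hq hqc.
have aE : n.+1%:R * (p + 1 - 2) / 4 = a by congr (_ * _ / _); ring.
rewrite aE in HC.
have sE : (p + 1) / 2 - a = 2 * r by rewrite /a /r; field.
rewrite sE in HC.
have gn : forall (u : 'rV[R]_n.+1 -> R) g (rho G : R),
    H10 Om u g -> 0 <= rho -> 0 < G ->
    (L2sq Om u <= rho%:E)%E -> (Dsq Om g <= G%:E)%E ->
    (intO Om (fun x => `|u x| `^ (p + 1))%R <= (C * G `^ a * rho `^ (2 * r))%:E)%E.
  by move=> u g rho G; exact: HC.
split; first by move=> mu1 mu2 beta _ _; exact: star_shaped_admissible oO p1 C0 gn _ _ _.
have [phi1 [phi2 [K [b1 b2 K0 dis]]]] := disjoint_bumps oO O0.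
have [t1 L1 D1] := b1.
have /andP[l0 lK] := lambda1_bounds t1 L1 D1.
pose al := K + 1; have al0 : 0 < al by rewrite ltr_wpDl.
have [R2 R20 HR2] : exists2 R2 : R, 0 < R2 & (2 < n.+1)%N ->
  forall mu1 mu2 beta rho : R, 0 < mu1 -> 0 < mu2 -> 0 < rho ->
    (Num.max mu1 mu2 + Num.max beta 0) * rho `^ (2 / (n.+1%:R - 2)) <= R2 ->
    rho * al <= @Lambda R n.+1 mu1 mu2 beta `^ (- ((n.+1%:R - 2) / 2)).
  have [N2|N2] := boolP (2 < n.+1)%N; last by exists 1.
  by have [R2 ? ?] := critical_mass_bound N2 al0; exists R2.
(* Solves [2 * C * al ^ a * R1 = (p + 1) / 4]. The interaction, divided by [p + 1], then costs at
   most a quarter of the mass, half of the margin that [al = K + 1] leaves over [K]. *)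
pose R1 := (p + 1) / (8 * (C * al `^ a)).
have R10 : 0 < R1.
  by rewrite divr_gt0 ?mulr_gt0 ?powR_gt0//; lra.
exists (Num.min R1 R2); split; first by rewrite lt_min R10.
move=> mu1 mu2 beta rho1 rho2 m1 m2 r1 r2; rewrite le_min => /andP[hR1 hR2].
have [r0|r0] := eqVneq (rho1 + rho2) 0.
  by right; congr (_, _); lra.
pose rr := rho1 + rho2.
have rr0 : 0 < rr by rewrite lt0r r0 addr_ge0.
left; split=> //; split=> //; exists al; split; first by rewrite /al /=; lra.
- have [w [Mw gw Ew]] := energy_testfun oO p1 C0 gn beta (ltW m1) (ltW m2) r1 r2 K0 b1 b2 dis.
  rewrite -/rr in gw Ew.
  apply: (@le_lt_trans _ _ (2^-1 * (rr * K))%:E).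
    apply: le_trans Ew; apply: ereal_inf_lbound; exists w => //; split=> //=.
    by apply: le_trans gw _; rewrite lee_fin ler_wpM2l ?(ltW rr0)// lerDl.
  apply: (@lt_le_trans _ _ (2^-1 * (rr * K) + 4^-1 * rr)%:E).
    by rewrite lte_fin ltrDl mulr_gt0.
  apply: le_ereal_inf_tmp => _ [v [Mv gv] <-].
  have gv' : (gradsum Om v <= (rr * al)%:E)%E by rewrite gv.
  have [D [I1 [I12 [I2 [_ I10 I120 I20 [DE [He HI]]]]]]] :=
    energy_data oO p1 C0 gn r1 r2 Mv gv'.
  have DA : D = rr * al by move: DE; rewrite gv => -[].
  have [_ _] := He mu1 mu2 beta 1 ler01.
  rewrite scalew1 expr1n powR1 !mul1r => ->; rewrite lee_fin.
  have G0 : 0 < rr * al by rewrite mulr_gt0.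
  have [h1 h2 h12] : [/\ I1 <= C * (rr * al) `^ a * rho1 `^ (2 * r),
       I2 <= C * (rr * al) `^ a * rho2 `^ (2 * r) &
       I12 <= C * (rr * al) `^ a * (rho1 `^ r * rho2 `^ r)].
    have := HI _ G0; rewrite (_ : 2 * r / 2 = r); last by field.
    by apply; rewrite DA.
  set Q := C * (rr * al) `^ a in h1 h2 h12.
  have Q0 : 0 <= Q by rewrite mulr_ge0 ?powR_ge0 ?(ltW C0).
  set M := Num.max (mu1 * _) _ in hR1; set b := Num.max beta 0 in hR1.
  have F1 : mu1 * I1 <= Q * M.
    apply: le_trans (ler_wpM2l (ltW m1) h1) _; rewrite mulrCA ler_wpM2l//.
    by rewrite le_max lexx.
  have F2 : mu2 * I2 <= Q * M.
    apply: le_trans (ler_wpM2l (ltW m2) h2) _; rewrite mulrCA ler_wpM2l//.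
    by rewrite le_max lexx orbT.
  (* As [I12] is nonnegative, [beta] may be replaced by its positive part. *)
  have F12 : beta * I12 <= Q * (b * rho1 `^ r * rho2 `^ r).
    apply: (@le_trans _ _ (b * I12)); first by rewrite ler_wpM2r// le_max lexx.
    have b0 : 0 <= b by rewrite le_max lexx orbT.
    by apply: le_trans (ler_wpM2l b0 h12) _; rewrite mulrCA -!mulrA.
  have F : mu1 * I1 + 2 * beta * I12 + mu2 * I2 <= 4^-1 * (p + 1) * rr.
    apply: (@le_trans _ _ (2 * (Q * (M + b * rho1 `^ r * rho2 `^ r)))); first by lra.
    (* One power of the total mass is split off: it is the factor needed in the bound, and the rest
       matches the smallness assumption. *)
    have -> : Q = C * al `^ a * rr * rr `^ (a - 1).
      rewrite /Q powRM ?(ltW rr0) ?(ltW al0)//.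
      have a0 : 0 < a by rewrite /a divr_gt0// mulr_gt0 ?ltr0n ?subr_gt0.
      by rewrite -(mulr_powRB1 (ltW rr0) a0); ring.
    rewrite (_ : 2 * _ = 2 * (C * al `^ a) * rr *
      ((M + b * rho1 `^ r * rho2 `^ r) * rr `^ (a - 1))); last by ring.
    have c0 : 0 < 2 * (C * al `^ a) * rr by rewrite !mulr_gt0 ?powR_gt0.
    apply: le_trans (ler_wpM2l (ltW c0) hR1) _.
    rewrite le_eqVlt; apply/orP; left; apply/eqP; rewrite /R1; field.
    by rewrite (gt_eqF C0) gt_eqF ?powR_gt0.
  have pp : 0 < (p + 1)^-1 by rewrite invr_gt0; lra.
  have F' : (p + 1)^-1 * (mu1 * I1 + 2 * beta * I12 + mu2 * I2) <= 4^-1 * rr.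
    apply: le_trans (ler_wpM2l (ltW pp) F) _.
    rewrite le_eqVlt; apply/orP; left; apply/eqP; field.
    by rewrite gt_eqF//; lra.
  rewrite DA /al; lra.
- move=> [N2 pE] /=.
  have N2R : n.+1%:R - 2 != 0 :> R by rewrite gt_eqF// subr_gt0 ltr_nat.
  apply: (@le_trans _ _ (rr * al)).
    by rewrite ler_wpM2l ?(ltW rr0)// gerBl.
  have [aE' rE] : a - 1 = 2 / (n.+1%:R - 2) /\ r = 0.
    have aux (t : R) : t - 2 != 0 -> t * (2 * t / (t - 2) - 1 - 1) / 4 - 1 = 2 / (t - 2) /\
      (2 * t / (t - 2) - 1 + 1) / 4 - t * (2 * t / (t - 2) - 1 - 1) / 8 = 0.
      by move=> t2; split; field.
    by have := aux n.+1%:R N2R; rewrite /a /r pE.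
  (* Since [0 ^ 0 = 1] for [powR], the assumption bounds [Num.max mu1 mu2 + Num.max beta 0] even if
     one of the masses is zero. *)
  apply: HR2 => //; move: hR2.
  by rewrite aE' rE mulr0 !powRr0 !mulr1.
Qed.
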